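(* Let $k$ and $c$ be rational numbers such that $1 < k < c < k^2$. Then there is no refuter $R(1^n,E_n)$ for $\mathsf{SAT}_n$ against $E_n \in \mathsf{coNSIZE}[n^k]$ that has nonuniform circuit size at most $n^c$ and succeeds on every large enough input length $n$. That is, there is no family of Boolean circuits $\{R_n\}$ with $R_n$ of size at most $n^c$ such that for all sufficiently large $n$ and every co-nondeterministic circuit $E_n$ on $n$ input bits of size at most $n^k$, $R_n(E_n)$ outputs a string $x\in\{0,1\}^n$ with $E_n(x)\neq \mathsf{SAT}_n(x)$.
   Context: $\mathsf{SAT}_n$ denotes the decision version of the satisfiability problem for De Morgan Boolean formulas represented (encoded) by $n$-bit strings: $\mathsf{SAT}_n(x)=1$ iff $x$ encodes a satisfiable formula. A co-nondeterministic circuit $E(x,z)$ (main input $x$, nondeterministic input $z$) computes $E(x)=1$ iff $E(x,z)=1$ for all $z$; $\mathsf{coNSIZE}[s(n)]$ denotes co-nondeterministic circuits of size $s(n)$. A refuter for $L$ against a class $\mathcal{C}$ succeeds on input length $n$ if for every $E\in\mathcal{C}$ on $n$ inputs it outputs $x\in\{0,1\}^n$ with $E(x)\neq L(x)$; the refuter receives the description of $E$ as input. *)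

(* Defs.v *)
From mathcomp Require Import all_boot all_order all_algebra.

Set Implicit Arguments.
Unset Strict Implicit.
Unset Printing Implicit Defensive.

Import Order.TTheory GRing.Theory Num.Theory.

(* powfloor n k is the integer part of n ^ k for a rational k >= 0: the largest
   s such that s ^ q <= n ^ p, where k = p / q in lowest terms.  A natural
   number is at most n ^ k iff it is at most powfloor n k; see powfloorP. *)
Definition powfloor (n : nat) (k : rat) : nat :=
  \max_(s < (n ^ `|numq k|).+1 | s ^ `|denq k| <= n ^ `|numq k|) s.

Lemma leq_powfloor (n : nat) (k : rat) (s : nat) :
  (s <= powfloor n k) = (s ^ `|denq k| <= n ^ `|numq k|).
Proof.
have q_gt0 : 0 < `|denq k| by rewrite absz_gt0 denq_neq0.
apply/idP/idP => [le_s | le_sq].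
  have max_ok : powfloor n k ^ `|denq k| <= n ^ `|numq k|.
    rewrite /powfloor; elim/big_ind: _ => [|a b Ha Hb|//].
      by rewrite exp0n.
    by rewrite /maxn; case: ifP.
  by apply: leq_trans max_ok; rewrite leq_exp2r.
have lt_s : s < (n ^ `|numq k|).+1.
  rewrite ltnS; apply: leq_trans le_sq.
  case: s => // s; rewrite -{1}(expn1 s.+1).
  by rewrite leq_pexp2l.
exact: (@leq_bigmax_cond _ _ (fun i : 'I__ => (i : nat)) (Ordinal lt_s)).
Qed.

(* The hypotheses on x say that x is the real number n ^ k. *)
Lemma powfloorP (R : realFieldType) (n : nat) (k : rat) (x : R) (s : nat) :
  (0 <= x -> x ^+ `|denq k| = n%:R ^+ `|numq k| ->
   (s%:R <= x) = (s <= powfloor n k)%N)%R.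
Proof.
move=> x_ge0 xE; have q_gt0 : 0 < `|denq k| by rewrite absz_gt0 denq_neq0.
rewrite leq_powfloor -(ler_nat R) !natrX -xE.
by rewrite ler_pXn2r // nnegrE ler0n.
Qed.

(* Little-endian binary representation of v on w bits. *)
Definition bits (w v : nat) : seq bool := mkseq (fun i => odd (v %/ 2 ^ i)) w.

Definition bitlen (v : nat) : nat := (trunc_log 2 v).+1.

Definition zpad (len : nat) (s : seq bool) : len.-tuple bool :=
  [tuple nth false s i | i < len].

(* Circuits of fan-in two over AND, OR, NOT.  The nodes of a circuit with p
   inputs are numbered: the inputs are the nodes 0, ..., p - 1 and the gate at
   position i of the list is the node p + i. *)
Inductive gate : Type :=
  | GNot of nat
  | GAnd of nat & nat
  | GOr of nat & nat.

Definition gate_args (g : gate) : seq nat :=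
  match g with
  | GNot a => [:: a]
  | GAnd a b | GOr a b => [:: a; b]
  end.

Fixpoint gates_wf (m : nat) (gs : seq gate) : bool :=
  if gs is g :: gs' then all (fun a => a < m) (gate_args g) && gates_wf m.+1 gs'
  else true.

Record circuit (p q : nat) : Type := Circuit {
  gates : seq gate;
  outputs : q.-tuple nat;
  circuit_wf :
    gates_wf p gates && all (fun a => a < p + size gates) outputs
}.

Definition circuit_size (p q : nat) (C : circuit p q) : nat := size (gates C).

Definition gate_val (vals : seq bool) (g : gate) : bool :=
  match g with
  | GNot a => ~~ nth false vals a
  | GAnd a b => nth false vals a && nth false vals b
  | GOr a b => nth false vals a || nth false vals b
  end.

Definition node_vals (inp : seq bool) (gs : seq gate) : seq bool :=
  foldl (fun vals g => rcons vals (gate_val vals g)) inp gs.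

Definition run (p q : nat) (C : circuit p q) (x : p.-tuple bool) :
    q.-tuple bool :=
  [tuple of map (nth false (node_vals x (gates C))) (outputs C)].

(* A co-nondeterministic circuit E(x, z) with main input x of n bits. *)
Record conCircuit (n : nat) : Type := ConCircuit {
  guess : nat;
  body : circuit (n + guess) 1
}.

(* The nondeterministic input bits are counted as nodes of the circuit, the
   main input bits are not. *)
Definition con_size (n : nat) (E : conCircuit n) : nat :=
  guess E + circuit_size (body E).

Definition con_eval (n : nat) (E : conCircuit n) (x : n.-tuple bool) : bool :=
  [forall z : (guess E).-tuple bool, thead (run (body E) [tuple of x ++ z])].

(* Descriptions of co-nondeterministic circuits on n inputs of size at most s,
   as strings of a length that depends only on n and s: the number of
   nondeterministic inputs, the output node, and the list of gates, completed
   with zeros.  A node address takes bitlen (n + s) bits; the gate tags are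
   nonzero, so the end of the list is recognizable. *)
Definition gate_code (w : nat) (g : gate) : seq bool :=
  match g with
  | GNot a => bits 2 1 ++ bits w a ++ bits w 0
  | GAnd a b => bits 2 2 ++ bits w a ++ bits w b
  | GOr a b => bits 2 3 ++ bits w a ++ bits w b
  end.

Definition desc_len (n s : nat) : nat :=
  let w := bitlen (n + s) in 2 * w + s * (2 + 2 * w).

Definition describe (n s : nat) (E : conCircuit n) :
    (desc_len n s).-tuple bool :=
  let w := bitlen (n + s) in
  zpad (desc_len n s)
    (bits w (guess E) ++ bits w (thead (outputs (body E)))
     ++ flatten (map (gate_code w) (gates (body E)))).

Inductive formula : Type :=
  | FVar of nat
  | FNot of formula
  | FAnd of formula & formula
  | FOr of formula & formula.

Fixpoint feval (a : nat -> bool) (phi : formula) : bool :=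
  match phi with
  | FVar v => a v
  | FNot f => ~~ feval a f
  | FAnd f g => feval a f && feval a g
  | FOr f g => feval a f || feval a g
  end.

Definition satisfiable (phi : formula) : Prop :=
  exists a : nat -> bool, feval a phi.

Fixpoint fsize (phi : formula) : nat :=
  match phi with
  | FVar _ => 1
  | FNot f => (fsize f).+1
  | FAnd f g | FOr f g => (fsize f + fsize g).+1
  end.

Fixpoint vars_below (m : nat) (phi : formula) : bool :=
  match phi with
  | FVar v => v < m
  | FNot f => vars_below m f
  | FAnd f g | FOr f g => vars_below m f && vars_below m g
  end.

(* A formula is written as the list of the nodes of its tree in postorder, the
   first one having address d; each node is a 3-bit tag followed by two fields
   of w bits, containing the addresses of its children or the index of its
   variable. *)
Fixpoint formula_code (w d : nat) (phi : formula) : seq bool :=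
  match phi with
  | FVar v => bits 3 1 ++ bits w v ++ bits w 0
  | FNot f =>
      formula_code w d f
      ++ bits 3 2 ++ bits w (d + fsize f).-1 ++ bits w 0
  | FAnd f g =>
      formula_code w d f ++ formula_code w (d + fsize f) g
      ++ bits 3 3 ++ bits w (d + fsize f).-1
      ++ bits w (d + fsize f + fsize g).-1
  | FOr f g =>
      formula_code w d f ++ formula_code w (d + fsize f) g
      ++ bits 3 4 ++ bits w (d + fsize f).-1
      ++ bits w (d + fsize f + fsize g).-1
  end.

(* Fields have width bitlen n.  The code is completed with zeros, so that every
   formula whose code has at most n bits is encoded by a string of length n. *)
Definition encodes (n : nat) (x : n.-tuple bool) (phi : formula) : Prop :=
  [/\ vars_below (2 ^ bitlen n) phi,
      size (formula_code (bitlen n) 0 phi) <= n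
    & x = zpad n (formula_code (bitlen n) 0 phi)].

Definition SAT (n : nat) (x : n.-tuple bool) : Prop :=
  exists2 phi, encodes x phi & satisfiable phi.

(* The negated equivalence is E(x) <> SAT_n(x) for the two truth values. *)
Definition refuter_succeeds (n s : nat) (R : circuit (desc_len n s) n) : Prop :=
  forall E : conCircuit n, con_size E <= s ->
    let x := run R (describe s E) in ~ (con_eval E x <-> SAT x).

(* Main.v *)
Require Import Defs.
From mathcomp Require Import all_boot all_order all_algebra.
From mathcomp Require Import zify.
From Stdlib Require Import ClassicalEpsilon.

Set Implicit Arguments.
Unset Strict Implicit.
Unset Printing Implicit Defensive.
Import Order.TTheory GRing.Theory Num.Theory.

(* A refuter compresses satisfiability.  A formula x of n bits is turned into a
   co-nondeterministic circuit E_x on m < n inputs, of quasi-linear size in n,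
   that ignores its main input and accepts iff x has no satisfying assignment.
   As E_x is constant, the string R_m(E_x) on which it errs is satisfiable iff x
   is.  Take m about n ^ (1 / l) with c / k < l < k: then E_x has size at most
   m ^ k because l < k, while R_m has size m ^ c, well below n ^ k, because
   c < l k.  Iterating the compression down to a constant length yields
   deterministic circuits of size at most n ^ k for SAT_n, and these cannot be
   refuted. *)

(** * Circuits as functions on bit strings *)

(** The difficulty is that a circuit of size about [m ^ c] has to write down [E_x], although
    evaluating a formula means following addresses. The wiring of [E_x] therefore depends on [x]:
    the left operand of a binary node is the cell whose address is copied bit by bit from [x], so no
    lookup is computed. It remains to tell codes from other strings. Tags, ranges and padding are
    local and are tested on [x] itself by [code_check]; these tests also make all wires point
    backwards. That the left child of a node sits just before the beginning of the right subtree is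
    not local: [E_x] verifies it, by carrying the beginning of each subtree along the same wires.
    Storing the beginning minus one makes it directly comparable with the address of the left child,
    and a root subtree beginning at 0 shows as a word of ones. The induction runs upwards, from a
    length [m] to the integer part of [m ^ l]. The cost of a step is added to the size reached so
    far, never multiplied, so the last step dominates the sum. *)

Definition gate_eval (V : nat -> bool) (g : gate) : bool :=
  match g with
  | GNot a => ~~ V a
  | GAnd a b => V a && V b
  | GOr a b => V a || V b
  end.

Lemma gate_valE vals g : gate_val vals g = gate_eval (nth false vals) g.
Proof. by case: g. Qed.

Lemma eq_gate_eval (V1 V2 : nat -> bool) g :
  {in gate_args g, V1 =1 V2} -> gate_eval V1 g = gate_eval V2 g.
Proof. by case: g => [a|a b|a b] /= h; rewrite !h ?inE ?eqxx ?orbT. Qed.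

Definition map_gate (rho : nat -> nat) (g : gate) : gate :=
  match g with
  | GNot a => GNot (rho a)
  | GAnd a b => GAnd (rho a) (rho b)
  | GOr a b => GOr (rho a) (rho b)
  end.

Lemma gate_args_map rho g : gate_args (map_gate rho g) = map rho (gate_args g).
Proof. by case: g. Qed.

Lemma gate_eval_map V rho g :
  gate_eval V (map_gate rho g) = gate_eval (fun a => V (rho a)) g.
Proof. by case: g. Qed.

Lemma gates_wf_cat m gs1 gs2 :
  gates_wf m (gs1 ++ gs2) = gates_wf m gs1 && gates_wf (m + size gs1) gs2.
Proof.
elim: gs1 m => [|g gs IH] m /=; first by rewrite addn0.
by rewrite IH addSnnS andbA.
Qed.

Lemma gates_wf_nth m gs :
  (forall j, j < size gs ->
     all (fun a => a < m + j) (gate_args (nth (GNot 0) gs j))) ->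
  gates_wf m gs.
Proof.
elim: gs m => [|g gs IH] m //= h; apply/andP; split.
  by have := h 0 isT; rewrite addn0.
by apply: IH => j lt_j; have := h j.+1 lt_j; rewrite addSnnS.
Qed.

Lemma node_vals_cat inp gs1 gs2 :
  node_vals inp (gs1 ++ gs2) = node_vals (node_vals inp gs1) gs2.
Proof. by rewrite /node_vals foldl_cat. Qed.

Lemma node_vals_rcons inp gs g :
  node_vals inp (rcons gs g) =
  rcons (node_vals inp gs) (gate_val (node_vals inp gs) g).
Proof. by rewrite -cats1 node_vals_cat. Qed.

Lemma size_node_vals inp gs : size (node_vals inp gs) = size inp + size gs.
Proof.
elim/last_ind: gs => [|gs g IH]; first by rewrite addn0.
by rewrite node_vals_rcons !size_rcons IH addnS.
Qed.

Lemma nth_node_vals_inp inp gs a :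
  a < size inp -> nth false (node_vals inp gs) a = nth false inp a.
Proof.
elim/last_ind: gs => [|gs g IH] // lt_a.
by rewrite node_vals_rcons nth_rcons size_node_vals ltn_addr // IH.
Qed.

(** Well-formedness lets every gate equation be stated with the final list of values, although that
    list is built from left to right. The values of [E_x] are studied through these equations
    alone. *)
Lemma nth_node_vals_gate inp gs j :
  gates_wf (size inp) gs -> j < size gs ->
  nth false (node_vals inp gs) (size inp + j) =
  gate_eval (nth false (node_vals inp gs)) (nth (GNot 0) gs j).
Proof.
elim/last_ind: gs => [|gs g IH] //.
rewrite -cats1 gates_wf_cat /= andbT => /andP[wf_gs /allP wf_g].
rewrite cats1 size_rcons ltnS => le_j.
rewrite node_vals_rcons !nth_rcons size_node_vals ltn_add2l eqn_add2l.
have old a : a < size inp + size gs ->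
    nth false (rcons (node_vals inp gs) (gate_val (node_vals inp gs) g)) a
    = nth false (node_vals inp gs) a.
  by move=> lt_a; rewrite nth_rcons size_node_vals lt_a.
case: ltnP => [lt_j|ge_j].
  rewrite IH //; apply: eq_gate_eval => a a_in; rewrite old //.
  have : all (fun a => a < size inp + j) (gate_args (nth (GNot 0) gs j)).
    move: wf_gs; rewrite -(cat_take_drop j gs) gates_wf_cat => /andP[_].
    rewrite (drop_nth (GNot 0)) //= size_takel ?(ltnW lt_j) // => /andP[].
    by rewrite nth_cat size_takel ?(ltnW lt_j) // ltnn subnn.
  by move/allP/(_ _ a_in); lia.
have -> : j == size gs by rewrite eqn_leq le_j ge_j.
rewrite gate_valE; apply: eq_gate_eval => a a_in.
by rewrite old //; apply: wf_g.
Qed.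

(* Embedding of a circuit with inputs [map V outs] into a larger circuit whose
   first P nodes are given: its inputs are read at [outs], its gates shifted. *)
Definition embed_node (P : nat) (outs : seq nat) (a : nat) : nat :=
  if a < size outs then nth 0 outs a else a - size outs + P.

Lemma embed_gates P outs gs (inp : seq bool) :
  size inp = P -> all (fun a => a < P) outs -> gates_wf (size outs) gs ->
  let gs' := map (map_gate (embed_node P outs)) gs in
  gates_wf P gs' /\
  forall a, a < size outs + size gs ->
    embed_node P outs a < P + size gs /\
    nth false (node_vals inp gs') (embed_node P outs a) =
    nth false (node_vals (map (nth false inp) outs) gs) a.
Proof.
move=> szP /all_nthP outsP wf; cbv zeta.
have lt_emb a j : a < size outs + j -> embed_node P outs a < P + j.
  rewrite /embed_node; case: (ltnP a (size outs)) => [lt_a _|]; last by lia.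
  by have /= := outsP 0 a lt_a; lia.
elim/last_ind: gs wf => [|gs g IH] wf.
  split => // a; rewrite addn0 => lt_a; split.
    by apply: lt_emb; rewrite addn0.
  by rewrite /= /embed_node lt_a (nth_map 0).
move: wf; rewrite -cats1 gates_wf_cat /= andbT => /andP[wf_gs wf_g].
have [wf' IHv] := IH wf_gs.
rewrite cats1 map_rcons; split.
  rewrite -cats1 gates_wf_cat wf' /= andbT gate_args_map all_map size_map.
  by apply: sub_all wf_g => a /= /lt_emb.
move=> a; rewrite size_rcons addnS ltnS => le_a; split.
  by apply: lt_emb; rewrite addnS ltnS.
rewrite !node_vals_rcons !nth_rcons !size_node_vals size_map szP size_map.
case: (ltnP a) => [lt_a|ge_a].
  by rewrite lt_emb // (IHv a lt_a).2.
have -> : a = size outs + size gs by lia.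
have -> : embed_node P outs (size outs + size gs) = P + size gs.
  by rewrite /embed_node ltnNge leq_addr /=; lia.
rewrite !ltnn !eqxx !gate_valE gate_eval_map; apply: eq_gate_eval => b b_in.
by rewrite (IHv b _).2 //; apply: (allP wf_g).
Qed.

(** Only strings of length [p] count, and any node may serve as an output, so selecting and
    rearranging input bits has cost 0. *)
Definition computes (p s : nat) (f : seq bool -> seq bool) : Prop :=
  exists gs outs,
    [/\ gates_wf p gs, all (fun a => a < p + size gs) outs, size gs <= s
      & forall x, size x = p -> map (nth false (node_vals x gs)) outs = f x].

Definition computes1 (p s : nat) (f : seq bool -> bool) : Prop :=
  computes p s (fun x => [:: f x]).

Lemma computesW p s s' f g :
  computes p s f -> s <= s' -> (forall x, size x = p -> f x = g x) ->
  computes p s' g.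
Proof.
move=> [gs [outs [wf wfo le_s fP]]] le_ss eq_fg; exists gs, outs; split=> //.
  exact: leq_trans le_s le_ss.
by move=> x szx; rewrite fP // eq_fg.
Qed.

Lemma computes_select p l :
  all (fun a => a < p) l -> computes p 0 (fun x => map (nth false x) l).
Proof. by move=> lt_l; exists [::], l; split=> //=; rewrite addn0. Qed.

Lemma computes_comp p q s1 s2 f g :
  computes p s1 f -> computes q s2 g ->
  (forall x, size x = p -> size (f x) = q) ->
  computes p (s1 + s2) (fun x => g (f x)).
Proof.
move=> [gs1 [o1 [wf1 wfo1 le1 fP]]] [gs2 [o2 [wf2 wfo2 le2 gP]]] szf.
(* The number of outputs is read off from one sample input, since the embedding must not depend on
   [x]. *)
have szo1 : size o1 = q.
  by rewrite -(szf (nseq p false)) ?size_nseq // -fP ?size_nseq // size_map.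
have emb x : size x = p -> _ :=
  fun szx => @embed_gates (p + size gs1) o1 gs2 (node_vals x gs1)
    (etrans (size_node_vals _ _) (f_equal (addn^~ _) szx)) wfo1
    (eq_ind_r (gates_wf^~ gs2) wf2 szo1).
have [wf' wfo'] := emb (nseq p false) (size_nseq _ _).
exists (gs1 ++ map (map_gate (embed_node (p + size gs1) o1)) gs2).
exists (map (embed_node (p + size gs1) o1) o2); split.
- by rewrite gates_wf_cat wf1.
- rewrite size_cat size_map addnA all_map; apply: sub_all wfo2 => a /= lt_a.
  by have [] := wfo' a; rewrite ?szo1.
- by rewrite size_cat size_map leq_add.
move=> x szx; rewrite -gP ?szf // -fP // -map_comp; apply/eq_in_map => a a_in.
have [_ embV] := emb x szx; rewrite /= node_vals_cat.
by apply: (embV a _).2; rewrite szo1; apply: (allP wfo2).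
Qed.

Lemma computes_cat p s1 s2 f g :
  computes p s1 f -> computes p s2 g ->
  computes p (s1 + s2) (fun x => f x ++ g x).
Proof.
move=> [gs1 [o1 [wf1 wfo1 le1 fP]]] [gs2 [o2 [wf2 wfo2 le2 gP]]].
(* Feeding the second circuit from the nodes [0, ..., p - 1] makes both circuits read the same
   string. *)
have io : all (fun a => a < p + size gs1) (iota 0 p).
  by apply/allP => a; rewrite mem_iota; lia.
have emb x : size x = p -> _ :=
  fun szx => @embed_gates (p + size gs1) (iota 0 p) gs2 (node_vals x gs1)
    (etrans (size_node_vals _ _) (f_equal (addn^~ _) szx)) io
    (eq_ind_r (gates_wf^~ gs2) wf2 (size_iota 0 p)).
have [wf' wfo'] := emb (nseq p false) (size_nseq _ _).
exists (gs1 ++ map (map_gate (embed_node (p + size gs1) (iota 0 p))) gs2).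
exists (o1 ++ map (embed_node (p + size gs1) (iota 0 p)) o2); split.
- by rewrite gates_wf_cat wf1.
- rewrite size_cat size_map addnA all_cat all_map; apply/andP; split.
    by apply: sub_all wfo1 => a /=; lia.
  apply: sub_all wfo2 => a /= lt_a.
  by have [] := wfo' a; rewrite ?size_iota.
- by rewrite size_cat size_map leq_add.
move=> x szx; rewrite -fP // -gP // map_cat; congr (_ ++ _).
  apply/eq_in_map => a a_in; rewrite node_vals_cat nth_node_vals_inp //.
  by rewrite size_node_vals szx; apply: (allP wfo1).
rewrite -map_comp; apply/eq_in_map => a a_in.
have [_ embV] := emb x szx; rewrite /= node_vals_cat.
rewrite (embV a _).2 ?size_iota; last by apply: (allP wfo2).
congr (nth _ (node_vals _ _) _); apply: (@eq_from_nth _ false).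
  by rewrite size_map size_iota.
rewrite size_map size_iota => i lt_i.
by rewrite (nth_map 0) ?size_iota // nth_iota // nth_node_vals_inp ?szx.
Qed.

Lemma computes_flatten p s (F : nat -> seq bool -> seq bool) l :
  (forall i, i < l -> computes p s (F i)) ->
  computes p (l * s) (fun x => flatten (mkseq (F^~ x) l)).
Proof.
elim: l => [|l IH] h.
  by apply: computesW (computes_select (l := [::]) _) _ _.
have cl : computes p (l * s) (fun x => flatten (mkseq (F^~ x) l)).
  by apply: IH => i lt_i; apply: h; apply: ltnW.
apply: computesW (computes_cat cl (h l _)) _ _ => // [|x _].
  by rewrite mulSn addnC.
by rewrite /mkseq -addn1 iotaD map_cat flatten_cat /= cats0.
Qed.

Lemma computes_mkseq p s (F : nat -> seq bool -> bool) l :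
  (forall i, i < l -> computes1 p s (F i)) ->
  computes p (l * s) (fun x => mkseq (F^~ x) l).
Proof.
move=> h; apply: computesW (computes_flatten h) _ _ => // x _.
by rewrite /mkseq; elim: (iota _ _) => //= a r ->.
Qed.

Lemma computes_slice p o l :
  o + l <= p -> computes p 0 (fun x => take l (drop o x)).
Proof.
move=> le_p.
apply: computesW (@computes_select p (iota o l) _) _ _ => //.
  by apply/allP => a; rewrite mem_iota; lia.
move=> x szx; apply: (@eq_from_nth _ false).
  by rewrite size_map size_iota size_takel // size_drop szx; lia.
rewrite size_map size_iota => i lt_i.
by rewrite (nth_map 0) ?size_iota // nth_iota // nth_take // nth_drop.
Qed.

Lemma computes1_nth p i : i < p -> computes1 p 0 (fun x => nth false x i).
Proof. by move=> lt_i; apply: (@computes_select p [:: i]); rewrite /= lt_i. Qed.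

Lemma computes1_not p s f :
  computes1 p s f -> computes1 p s.+1 (fun x => ~~ f x).
Proof.
move=> cf; rewrite -addn1.
have cn : computes 1 1 (fun y => [:: ~~ nth false y 0]).
  by exists [:: GNot 0], [:: 1]; split=> // -[|b []].
exact: computesW (computes_comp cf cn _) _ _.
Qed.

Lemma computes1_and p s1 s2 f g :
  computes1 p s1 f -> computes1 p s2 g ->
  computes1 p (s1 + s2).+1 (fun x => f x && g x).
Proof.
move=> cf cg; rewrite -addn1.
have cn : computes 2 1 (fun y => [:: nth false y 0 && nth false y 1]).
  by exists [:: GAnd 0 1], [:: 2]; split=> // -[|b [|b' []]].
exact: computesW (computes_comp (computes_cat cf cg) cn _) _ _.
Qed.

Lemma computes1_or p s1 s2 f g :
  computes1 p s1 f -> computes1 p s2 g ->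
  computes1 p (s1 + s2).+1 (fun x => f x || g x).
Proof.
move=> cf cg; rewrite -addn1.
have cn : computes 2 1 (fun y => [:: nth false y 0 || nth false y 1]).
  by exists [:: GOr 0 1], [:: 2]; split=> // -[|b [|b' []]].
exact: computesW (computes_comp (computes_cat cf cg) cn _) _ _.
Qed.

Lemma computes1_const p b : 0 < p -> computes1 p 2 (fun=> b).
Proof.
move=> p_gt0; have c0 := computes1_nth p_gt0; have cn := computes1_not c0.
case: b.
  by apply: computesW (computes1_or c0 cn) _ _ => // x _; rewrite orbN.
by apply: computesW (computes1_and c0 cn) _ _ => // x _; rewrite andbN.
Qed.

Lemma computes_const p c : 0 < p -> computes p (2 * size c) (fun=> c).
Proof.
move=> p_gt0; rewrite mulnC.
apply: computesW (@computes_mkseq p 2 (fun i _ => nth false c i) _ _) _ _ => //.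
  by move=> i _; apply: computes1_const.
by move=> x _; rewrite mkseq_nth.
Qed.

Lemma computes1_if p s0 s1 s2 b f g :
  computes1 p s0 b -> computes1 p s1 f -> computes1 p s2 g ->
  computes1 p (2 * s0 + s1 + s2 + 4) (fun x => if b x then f x else g x).
Proof.
move=> cb cf cg.
apply: computesW (computes1_or (computes1_and cb cf)
  (computes1_and (computes1_not cb) cg)) _ _; first by lia.
by move=> x _; case: (b x); rewrite /= ?orbF.
Qed.

Lemma computes_if p s0 s1 s2 l b f g :
  computes1 p s0 b -> computes p s1 f -> computes p s2 g ->
  (forall x, size x = p -> size (f x) = l) ->
  (forall x, size x = p -> size (g x) = l) ->
  computes p (s0 + s1 + s2 + 4 * l) (fun x => if b x then f x else g x).
Proof.
move=> cb cf cg szf szg.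
have cm : computes (1 + l + l) (l * 4)
    (fun y => mkseq (fun i => if nth false y 0 then nth false y (1 + i)
                              else nth false y (1 + l + i)) l).
  by apply: computes_mkseq => i lt_i; apply: (@computes1_if _ 0 0 0);
    apply: computes1_nth; lia.
apply: computesW (computes_comp (computes_cat (computes_cat cb cf) cg) cm _) _ _.
- by move=> x szx; rewrite /= size_cat szf // szg.
- by rewrite [4 * l]mulnC.
move=> x szx /=; apply: (@eq_from_nth _ false).
  by rewrite size_mkseq; case: ifP; rewrite ?szf ?szg.
rewrite size_mkseq => i lt_i; rewrite nth_mkseq //.
case: (b x); rewrite /= nth_cat szf // ?lt_i //.
by rewrite ltnNge leq_addr addKn.
Qed.

Lemma computes1_all p s (F : nat -> seq bool -> bool) l : 0 < p ->
  (forall i, i < l -> computes1 p s (F i)) ->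
  computes1 p (l * s.+1 + 2) (fun x => all (F^~ x) (iota 0 l)).
Proof.
move=> p_gt0; elim: l => [|l IH] h; first exact: computes1_const.
apply: computesW (computes1_and (IH _) (h l _)) _ _ => //.
- by move=> i lt_i; apply: h; apply: ltnW.
- by lia.
by move=> x _; rewrite -addn1 iotaD all_cat /= andbT.
Qed.

(** Branching on one bit after another gives a decision tree of exponential size. It is used only at
    the single length where the iteration starts, where its size is a constant. *)
Lemma computes1_any p (h : seq bool -> bool) :
  0 < p -> exists s, computes1 p s h.
Proof.
move=> p_gt0.
suff H t : t <= p -> forall h', exists s, computes1 p s (fun x => h' (take t x)).
  have [s cs] := H p (leqnn p) h; exists s; apply: computesW cs _ _ => // x szx.
  by rewrite take_oversize ?szx.
elim: t => [|t IH] le_t h'.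
  by exists 2; apply: computesW (computes1_const (h' [::]) p_gt0) _ _ => // x _;
    rewrite take0.
have [s1 c1] := IH (ltnW le_t) (fun y => h' (rcons y true)).
have [s2 c2] := IH (ltnW le_t) (fun y => h' (rcons y false)).
exists (2 * 0 + s1 + s2 + 4).
apply: computesW (computes1_if (computes1_nth le_t) c1 c2) _ _ => // x szx.
by rewrite (take_nth false) ?szx //; case: (nth _ _ _).
Qed.

Lemma computes_run p q (C : circuit p q) :
  computes p (circuit_size C)
    (fun y => map (nth false (node_vals y (gates C))) (outputs C)).
Proof.
by case: C => gs outs wf; exists gs, outs; split=> //=; case/andP: wf.
Qed.

Lemma computes1_circuit p s f : computes1 p s f ->
  exists2 C : circuit p 1, circuit_size C <= s
    & forall x : p.-tuple bool, thead (run C x) = f x.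
Proof.
move=> [gs [outs [wf wfo le_s fP]]].
have szo : size outs == 1.
  by have := f_equal size (fP (nseq p false) (size_nseq _ _)); rewrite size_map => ->.
have wfC : gates_wf p gs && all (fun a => a < p + size gs) (Tuple szo).
  by rewrite wf.
exists (Circuit wfC) => // x.
rewrite /thead (tnth_nth false) /run /=.
by have -> := fP x (size_tuple x).
Qed.

(** * Binary numbers and the nodes of an encoded formula *)

Local Arguments bits : simpl never.

Lemma size_bits w v : size (bits w v) = w.
Proof. by rewrite size_mkseq. Qed.

Lemma bitsS w v : bits w.+1 v = odd v :: bits w v./2.
Proof.
rewrite /bits /mkseq /= expn0 divn1; congr (_ :: _).
rewrite -[1]addn0 iotaDl -map_comp; apply: eq_map => i /=.
by rewrite add1n expnS divnMA divn2.
Qed.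

Lemma bits_cat w1 w2 u v :
  u < 2 ^ w1 -> bits (w1 + w2) (u + 2 ^ w1 * v) = bits w1 u ++ bits w2 v.
Proof.
elim: w1 u => [|w1 IH] u.
  by rewrite expn0 ltnS leqn0 => /eqP->; rewrite add0n mul1n.
rewrite expnS addSn !bitsS => lt_u /=; rewrite -IH; last by lia.
congr (_ :: bits _ _); last by lia.
by rewrite oddD -mulnA mul2n odd_double addbF.
Qed.

(** Truncation to [w] bits is reduction modulo [2 ^ w]; thus [s + (2 ^ w).-1] stands for [s - 1],
    with wrap-around at [s = 0]. *)
Lemma bits_addX w u v : u < 2 ^ w -> bits w (u + 2 ^ w * v) = bits w u.
Proof. by move=> lt_u; have := bits_cat 0 v lt_u; rewrite addn0 cats0. Qed.

Fixpoint bnum (s : seq bool) : nat :=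
  if s is b :: s' then b + (bnum s').*2 else 0.

Lemma bnum_lt s : bnum s < 2 ^ size s.
Proof. by elim: s => //= b s IH; rewrite expnS; case: b; lia. Qed.

Lemma bits_bnum s : bits (size s) (bnum s) = s.
Proof.
elim: s => //= b s IH; rewrite bitsS -[in RHS]IH.
by congr (_ :: bits _ _); case: b; lia.
Qed.

Lemma bnum_bits w v : v < 2 ^ w -> bnum (bits w v) = v.
Proof.
elim: w v => [|w IH] v; first by rewrite expn0; case: v.
by rewrite expnS bitsS /= => lt_v; rewrite IH; lia.
Qed.

Lemma bits_inj w u v : u < 2 ^ w -> v < 2 ^ w -> bits w u = bits w v -> u = v.
Proof. by move=> lt_u lt_v e; rewrite -(bnum_bits lt_u) e bnum_bits. Qed.

Lemma nth_bnum s j : nth false s j = odd (bnum s %/ 2 ^ j).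
Proof.
elim: s j => [|b s IH] [|j] //=; rewrite ?div0n // ?expn0 ?divn1.
  by case: b; lia.
by rewrite IH expnS divnMA divn2; congr (odd (_ %/ _)); case: b; lia.
Qed.

Lemma bnum_eq w s v : size s = w -> v < 2 ^ w -> (bnum s == v) = (s == bits w v).
Proof.
move=> szs lt_v; apply/eqP/eqP => [<-|->]; first by rewrite -szs bits_bnum.
by rewrite bnum_bits.
Qed.

Lemma bnum_rcons s b : bnum (rcons s b) = bnum s + 2 ^ size s * b.
Proof.
elim: s => [|b' s IH] /=; first by rewrite expn0 mul1n addn0.
by rewrite IH expnS doubleD addnA -!mul2n mulnA.
Qed.

Definition field (x : seq bool) (o l : nat) : nat := bnum (take l (drop o x)).

Lemma field_lt x o l : field x o l < 2 ^ l.
Proof.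
apply: leq_trans (bnum_lt _) _; rewrite leq_exp2l // size_take_min.
by rewrite geq_minl.
Qed.

Lemma bits_field x o l :
  o + l <= size x -> bits l (field x o l) = take l (drop o x).
Proof.
move=> le_o; rewrite -[RHS]bits_bnum size_takel // size_drop; lia.
Qed.

Lemma computes1_slice_eq p o (c : seq bool) : 0 < p -> o + size c <= p ->
  computes1 p (2 * size c + 2) (fun x => take (size c) (drop o x) == c).
Proof.
move=> p_gt0; elim: c o => [|b c IH] o /= le_p.
  by apply: computesW (computes1_const true p_gt0) _ _ => // x _; rewrite take0.
have lt_o : o < p by lia.
have c1 : computes1 p 1 (fun x => nth false x o == b).
  have c0 := computes1_nth lt_o.
  case: b; first by apply: computesW c0 _ _ => // x _; rewrite eqb_id.
  by apply: computesW (computes1_not c0) _ _ => // x _; rewrite eqbF_neg.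
apply: computesW (computes1_and c1 (IH o.+1 _)) _ _; [by lia|by lia|].
by move=> x szx; rewrite (@drop_nth _ false o x) ?szx //=.
Qed.

Lemma computes1_field_eq p o l v : 0 < p -> o + l <= p -> v < 2 ^ l ->
  computes1 p (2 * l + 2) (fun x => field x o l == v).
Proof.
move=> p_gt0 le_p lt_v.
have := @computes1_slice_eq p o (bits l v) p_gt0; rewrite size_bits => /(_ le_p) c.
apply: computesW c _ _ => // x szx; rewrite (@bnum_eq l) //.
by rewrite size_takel // size_drop szx; lia.
Qed.

(** Recursion on the most significant bit, which comes last: either it settles the comparison, or
    the lower bits are compared with [v] or with [v - 2 ^ l]. *)
Lemma computes1_field_lt p o l v : 0 < p -> o + l <= p ->
  computes1 p (2 * l + 2) (fun x => field x o l < v).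
Proof.
move=> p_gt0; elim: l v => [|l IH] v le_p.
  by apply: computesW (computes1_const (0 < v) p_gt0) _ _ => // x _;
    rewrite /field take0.
have lt_o : o + l < p by lia.
have cb := computes1_not (computes1_nth lt_o).
have fE x : size x = p ->
    field x o l.+1 = field x o l + 2 ^ l * nth false x (o + l).
  move=> szx; rewrite /field (take_nth false) ?size_drop ?szx; last by lia.
  by rewrite bnum_rcons nth_drop size_takel // size_drop szx; lia.
case: (ltnP v (2 ^ l)) => [lt_v|ge_v].
  apply: computesW (computes1_and cb (IH v _)) _ _; [by lia|by lia|].
  move=> x szx; congr [:: _]; rewrite fE //; have := field_lt x o l.
  by case: (nth _ _ _) => /=; lia.
apply: computesW (computes1_or cb (IH (v - 2 ^ l) _)) _ _; [by lia|by lia|].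
move=> x szx; congr [:: _]; rewrite fE //; have := field_lt x o l.
by case: (nth _ _ _) => /=; lia.
Qed.

(** * Codes of formulas as lists of numerical triples *)

Section Nodes.
Variable w : nat.

Definition node_width : nat := 3 + (w + w).

Definition node (x : seq bool) (i : nat) : nat * nat * nat :=
  (field x (i * node_width) 3, field x (i * node_width + 3) w,
   field x (i * node_width + 3 + w) w).

Definition node_code (nd : nat * nat * nat) : seq bool :=
  bits 3 nd.1.1 ++ bits w nd.1.2 ++ bits w nd.2.

Definition node_small (nd : nat * nat * nat) : bool :=
  [&& nd.1.1 < 2 ^ 3, nd.1.2 < 2 ^ w & nd.2 < 2 ^ w].

Lemma size_node_code nd : size (node_code nd) = node_width.
Proof. by rewrite !size_cat !size_bits. Qed.

Lemma size_flatten_node_code nds :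
  size (flatten (map node_code nds)) = size nds * node_width.
Proof.
elim: nds => // nd r IH.
by rewrite -[flatten _]/(node_code nd ++ flatten _) size_cat size_node_code IH.
Qed.

Lemma node_codeE x i : i.+1 * node_width <= size x ->
  take node_width (drop (i * node_width) x) = node_code (node x i).
Proof.
rewrite mulSn /node_width => le_x.
rewrite /node_code; cbn [node fst snd]; rewrite /node_width !bits_field; try lia.
rewrite !takeD !drop_drop; congr (_ ++ (take _ (drop _ _) ++ _)); first lia.
by congr (take _ (drop _ _)); lia.
Qed.

Lemma node_decode x i nd : i.+1 * node_width <= size x -> node_small nd ->
  take node_width (drop (i * node_width) x) = node_code nd -> node x i = nd.
Proof.
case: nd => [[t a] b] le_x /and3P[/= lt_t lt_a lt_b].
rewrite node_codeE // /node_code; cbn [node fst snd].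
move/eqP; rewrite !eqseq_cat ?size_bits // => /and3P[/eqP e1 /eqP e2 /eqP e3].
rewrite /node (bits_inj _ _ e1) ?field_lt // (bits_inj _ _ e2) ?field_lt //.
by rewrite (bits_inj _ _ e3) ?field_lt.
Qed.

Lemma nth_flatten_uniform (ss : seq (seq bool)) W i u :
  all (fun s => size s == W) ss -> u < W ->
  nth false (flatten ss) (i * W + u) = nth false (nth [::] ss i) u.
Proof.
elim: ss i => [|s ss IH] i /=; first by rewrite !nth_nil.
move=> /andP[/eqP szs all_ss] lt_u; rewrite nth_cat szs.
case: i => [|i] /=; first by rewrite lt_u.
by rewrite mulSn -addnA ltnNge leq_addr /= addKn IH.
Qed.

(** The code of [(0, 0, 0)] consists of zeros, so completing a string with zeros amounts to
    completing the list of nodes with this default. *)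
Lemma nth_flatten_node_code nds i u : u < node_width ->
  nth false (flatten (map node_code nds)) (i * node_width + u) =
  nth false (node_code (nth (0, 0, 0) nds i)) u.
Proof.
move=> lt_u; rewrite nth_flatten_uniform //; last first.
  by rewrite all_map; apply/allP => nd _; apply/eqP/size_node_code.
case: (ltnP i (size nds)) => [lt_i|ge_i]; first by rewrite (nth_map (0, 0, 0)).
rewrite [nth [::] _ i]nth_default ?size_map // [nth _ nds i]nth_default //.
have bits0 l : bits l 0 = nseq l false.
  by elim: l => // l IH; rewrite bitsS /= -IH.
by rewrite /node_code !bits0 -!nseqD nth_nseq if_same nth_nil.
Qed.

(** The second clause concerns the bits after the last full block, as [n] may fail to be a multiple
    of the node width. *)
Lemma zpad_nodesP n (x : n.-tuple bool) nds :
  let N := n %/ node_width in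
  size nds <= N ->
  x = zpad n (flatten (map node_code nds)) <->
  (forall i, i < N -> take node_width (drop (i * node_width) x) =
                      node_code (nth (0, 0, 0) nds i)) /\
  (forall k, N * node_width <= k < n -> nth false x k = false).
Proof.
move=> N le_nds.
have W_gt0 : 0 < node_width by [].
have le_N i u : i < N -> u < node_width -> i * node_width + u < n.
  move=> lt_i lt_u; apply: leq_trans (leq_trunc_div n node_width).
  rewrite -/N; apply: (@leq_trans (i.+1 * node_width)); first by rewrite mulSn; lia.
  by rewrite leq_mul2r lt_i orbT.
have szfl := size_flatten_node_code nds.
have nth_z k : k < n -> nth false (zpad n (flatten (map node_code nds))) k =
    nth false (flatten (map node_code nds)) k.
  by move=> lt_k; rewrite -(tnth_nth _ _ (Ordinal lt_k)) tnth_mktuple.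
split=> [->|[blk tl]].
  split=> [i lt_i|k /andP[ge_k lt_k]].
    apply: (@eq_from_nth _ false).
      rewrite size_node_code size_takel // size_drop size_tuple.
      by have := le_N i node_width.-1 lt_i; lia.
    move=> u; rewrite size_take_min => lt_u.
    have {}lt_u : u < node_width by apply: leq_trans lt_u (geq_minl _ _).
    by rewrite nth_take // nth_drop nth_z ?le_N // nth_flatten_node_code.
  rewrite nth_z // nth_default // szfl; apply: leq_trans ge_k.
  by rewrite leq_mul2r le_nds orbT.
apply: val_inj; apply: (@eq_from_nth _ false); rewrite !size_tuple // => k lt_k.
rewrite nth_z //; case: (ltnP k (N * node_width)) => [lt_kN|ge_kN]; last first.
  rewrite tl ?ge_kN // nth_default // szfl; apply: leq_trans ge_kN.
  by rewrite leq_mul2r le_nds orbT.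
rewrite (divn_eq k node_width) nth_flatten_node_code ?ltn_mod //.
rewrite -blk ?ltn_divLR // nth_take ?ltn_mod // nth_drop //.
Qed.

Fixpoint formula_nodes (d : nat) (phi : formula) : seq (nat * nat * nat) :=
  match phi with
  | FVar v => [:: (1, v, 0)]
  | FNot f => formula_nodes d f ++ [:: (2, (d + fsize f).-1, 0)]
  | FAnd f g => formula_nodes d f ++ formula_nodes (d + fsize f) g
      ++ [:: (3, (d + fsize f).-1, (d + fsize f + fsize g).-1)]
  | FOr f g => formula_nodes d f ++ formula_nodes (d + fsize f) g
      ++ [:: (4, (d + fsize f).-1, (d + fsize f + fsize g).-1)]
  end.

Lemma formula_codeE d phi :
  formula_code w d phi = flatten (map node_code (formula_nodes d phi)).
Proof.
have flat1 nd : flatten (map node_code [:: nd]) = node_code nd.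
  exact: cats0.
elim: phi d => [v|f IHf|f IHf g IHg|f IHf g IHg] d;
  by rewrite [formula_nodes _ _]/= ?map_cat ?flatten_cat ?flat1 -?IHf -?IHg.
Qed.

Lemma size_formula_nodes d phi : size (formula_nodes d phi) = fsize phi.
Proof.
elim: phi d => [v|f IHf|f IHf g IHg|f IHf g IHg] d //=;
  by rewrite !size_cat IHf ?IHg /=; lia.
Qed.

Lemma fsize_gt0 phi : 0 < fsize phi.
Proof. by case: phi. Qed.

Lemma formula_nodes_small d phi : vars_below (2 ^ w) phi ->
  d + fsize phi <= 2 ^ w -> all node_small (formula_nodes d phi).
Proof.
rewrite /node_small.
elim: phi d => [v|f IHf|f IHf g IHg|f IHf g IHg] d /=; rewrite ?expn_gt0 //=.
- by move=> ->.
- move=> vb le_d; rewrite all_cat IHf //=; try lia.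
- move=> /andP[vf vg] le_d; rewrite !all_cat IHf ?IHg //=; try lia.
- move=> /andP[vf vg] le_d; rewrite !all_cat IHf ?IHg //=; try lia.
Qed.

End Nodes.

(** * The circuit E_x: layout and values *)

Lemma bits_ones w : bits w (2 ^ w).-1 = nseq w true.
Proof.
elim: w => // w IH; rewrite bitsS expnS.
have := expn_gt0 2 w; rewrite /= => gt0.
have -> : ((2 * 2 ^ w).-1)./2 = (2 ^ w).-1 by lia.
by rewrite IH /=; congr (_ :: _); lia.
Qed.

Section Layout.
Variables w be : nat.

(* The layout is aligned on powers of two, so that the binary address of a cell
   or of a variable is a concatenation of constants and of a field of x. *)
Definition cell (a o : nat) : nat := o + 2 ^ be * (a + 2 ^ w).

(** The two nodes just below [2 ^ (be + w)], the address of the first cell. *)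
Definition const_node (b : bool) : nat :=
  if b then (2 ^ (be + w)).-1 else (2 ^ (be + w)).-2.

Local Arguments const_node : simpl never.

Definition var_node (v : nat) : nat := v + 2 ^ w.

Definition copy_gate (a : nat) : gate := GAnd a a.

Definition is_binary (nd : nat * nat * nat) : bool :=
  (nd.1.1 == 3) || (nd.1.1 == 4).

(* Cell 0 of block i holds the value of the i-th node; cells 1 .. w hold the
   number s - 1 modulo 2 ^ w in binary, where s is the address of the first node
   of the subtree rooted at i; cells w + 1 .. 2 w compare the address of the left
   child of a binary node with that number for the right child i - 1; cells
   2 w + 1 .. 3 w accumulate the results of all comparisons made so far. *)
Definition block_gate (i o : nat) (nd : nat * nat * nat) : gate :=
  if o == 0 then
    if nd.1.1 == 1 then copy_gate (var_node nd.1.2)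
    else if nd.1.1 == 2 then GNot (cell i.-1 0)
    else if nd.1.1 == 3 then GAnd (cell nd.1.2 0) (cell i.-1 0)
    else if nd.1.1 == 4 then GOr (cell nd.1.2 0) (cell i.-1 0)
    else copy_gate (cell i.-1 0)
  else if o <= w then
    if nd.1.1 == 1 then
      copy_gate (const_node (odd ((i + (2 ^ w).-1) %/ 2 ^ o.-1)))
    else if is_binary nd then copy_gate (cell nd.1.2 o)
    else copy_gate (cell i.-1 o)
  else if o <= w + w then
    if is_binary nd then
      if odd (nd.1.2 %/ 2 ^ (o - w.+1)) then copy_gate (cell i.-1 (o - w))
      else GNot (cell i.-1 (o - w))
    else copy_gate (const_node true)
  else if o <= w + w + w then
    GAnd (cell i (o - w))
      (if o == (w + w).+1 then
         if i == 0 then const_node true else cell i.-1 (w + w + w)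
       else cell i o.-1)
  else copy_gate (const_node true).

(** In postorder the only child, or the right child, of node [i] is node [i.-1]. The left child of a
    binary node is only required to come earlier: its exact address is not determined by the node
    and its position. *)
Definition inner_ok (i : nat) (nd : nat * nat * nat) : bool :=
  [|| (nd.1.1 == 1) && (nd.2 == 0),
      (0 < i) && [&& nd.1.1 == 2, nd.1.2 == i.-1 & nd.2 == 0]
    | is_binary nd && ((nd.1.2 < i) && (nd.2 == i.-1))].

(** Here [nd'] is the next node: padding, once begun, lasts to the final block, and block 0 is never
    padding. *)
Definition block_ok (N i : nat) (nd nd' : nat * nat * nat) : bool :=
  inner_ok i nd ||
  (0 < i) && ([&& nd.1.1 == 0, nd.1.2 == 0 & nd.2 == 0] &&
              ((i.+1 == N) || (nd'.1.1 == 0))).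

Definition located (nd : nat -> nat * nat * nat) (d : nat) l : Prop :=
  forall k, k < size l -> nd (d + k) = nth (0, 0, 0) l k.

Lemma located_cat nd d l1 l2 :
  located nd d (l1 ++ l2) <-> located nd d l1 /\ located nd (d + size l1) l2.
Proof.
split=> [h|[h1 h2] k].
  split=> k lt_k; first by rewrite h ?size_cat ?ltn_addr // nth_cat lt_k.
  rewrite -addnA h ?size_cat ?ltn_add2l // nth_cat ltnNge leq_addr /=.
  by rewrite addKn.
rewrite size_cat nth_cat; case: (ltnP k (size l1)) => [lt_k _|ge_k lt_k].
  exact: h1.
by rewrite -h2; [congr (nd _); lia | lia].
Qed.

Lemma located1 nd d v : located nd d [:: v] <-> nd d = v.
Proof.
split=> [/(_ 0 isT)|h [|k]] //; first by rewrite addn0.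
by rewrite addn0.
Qed.

(** * The values of the cells under a fixed guess *)

Section Values.
Variables (N : nat) (nd : nat -> nat * nat * nat) (V : nat -> bool).
Hypothesis w_gt0 : 0 < w.
Hypothesis lt_be : w + w + w < 2 ^ be.
Hypothesis le_N : N <= 2 ^ w.
Hypothesis V_const : forall b, V (const_node b) = b.
Hypothesis V_cell : forall i o, i < N -> o < 2 ^ be ->
  V (cell i o) = gate_eval V (block_gate i o (nd i)).
Hypothesis nd_small : forall i, i < N -> (nd i).1.2 < 2 ^ w.

Definition start_bits (i : nat) : seq bool :=
  mkseq (fun j => V (cell i j.+1)) w.

(** The number stored in block [i.-1] is one less than the beginning of the right subtree, that is,
    the address where the left subtree has to end. *)
Definition cmp_ok (i : nat) : Prop :=
  is_binary (nd i) -> start_bits i.-1 = bits w (nd i).1.2.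

Lemma V_copy a : gate_eval V (copy_gate a) = V a.
Proof. by rewrite /= andbb. Qed.

Lemma value_cell i : i < N ->
  V (cell i 0) =
    if (nd i).1.1 == 1 then V (var_node (nd i).1.2)
    else if (nd i).1.1 == 2 then ~~ V (cell i.-1 0)
    else if (nd i).1.1 == 3 then V (cell (nd i).1.2 0) && V (cell i.-1 0)
    else if (nd i).1.1 == 4 then V (cell (nd i).1.2 0) || V (cell i.-1 0)
    else V (cell i.-1 0).
Proof.
move=> lt_i; rewrite V_cell ?expn_gt0 // /block_gate eqxx.
by do ![case: ifP => _ //]; rewrite V_copy.
Qed.

Lemma start_bits_cell i : i < N ->
  start_bits i =
    if (nd i).1.1 == 1 then bits w (i + (2 ^ w).-1)
    else if is_binary (nd i) then start_bits (nd i).1.2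
    else start_bits i.-1.
Proof.
move=> lt_i; apply: (@eq_from_nth _ false).
  by rewrite size_mkseq; do ![case: ifP => _]; rewrite size_mkseq.
rewrite size_mkseq => j lt_j.
have lt_o : j.+1 < 2 ^ be by lia.
rewrite nth_mkseq // V_cell // /block_gate /= lt_j.
by do ![case: ifP => _]; rewrite V_copy ?V_const nth_mkseq.
Qed.

Lemma cmp_okE i : i < N ->
  cmp_ok i <-> (forall j, j < w -> V (cell i (w + j.+1))).
Proof.
move=> lt_i.
have cE j : j < w -> V (cell i (w + j.+1)) =
    (is_binary (nd i) ==>
     (nth false (start_bits i.-1) j == nth false (bits w (nd i).1.2) j)).
  move=> lt_j; rewrite V_cell //; last by lia.
  rewrite /block_gate addnS /= ltnNge leq_addr /= -addnS leq_add2l lt_j.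
  have -> : w + j.+1 - w.+1 = j by lia.
  rewrite addKn /start_bits /bits !nth_mkseq //.
  case: is_binary; last by rewrite V_copy V_const.
  (* Equality with a bit of [x] is a copy or a negation, chosen when the circuit is written. *)
  by case: (odd _); rewrite ?V_copy /= ?eqb_id ?eqbF_neg.
rewrite /cmp_ok; split=> [h j lt_j|h bin].
  by rewrite cE //; apply/implyP => /h ->.
apply: (@eq_from_nth _ false); first by rewrite !size_mkseq.
rewrite size_mkseq => j lt_j.
by have := h j lt_j; rewrite cE // bin /= => /eqP.
Qed.

(** The chain of conjunctions through a block starts from the last accumulator of the previous
    block. *)
Lemma acc_cell i : i < N ->
  V (cell i (w + w + w)) <-> (forall i', i' <= i -> cmp_ok i').
Proof.
have step k : k < N -> forall j, j < w ->
    V (cell k (w + w + j.+1)) =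
    (if k == 0 then true else V (cell k.-1 (w + w + w)))
    && all (fun j' => V (cell k (w + j'.+1))) (iota 0 j.+1).
  move=> lt_k; elim=> [|j IH] lt_j; rewrite V_cell //; try lia.
    have -> : block_gate k (w + w + 1) (nd k) = GAnd (cell k (w + 1))
        (if k == 0 then const_node true else cell k.-1 (w + w + w)).
      rewrite /block_gate.
      have -> : w + w + 1 == 0 = false by lia.
      have -> : w + w + 1 <= w = false by lia.
      have -> : w + w + 1 <= w + w = false by lia.
      have -> : w + w + 1 <= w + w + w by lia.
      have -> : w + w + 1 == (w + w).+1 by lia.
      by congr (GAnd (cell _ _) _); lia.
    by rewrite /= andbT andbC; case: eqP => // _; rewrite V_const.
  have -> : block_gate k (w + w + j.+2) (nd k) =
      GAnd (cell k (w + j.+2)) (cell k (w + w + j.+1)).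
    rewrite /block_gate.
    have -> : w + w + j.+2 == 0 = false by lia.
    have -> : w + w + j.+2 <= w = false by lia.
    have -> : w + w + j.+2 <= w + w = false by lia.
    have -> : w + w + j.+2 <= w + w + w by lia.
    have -> : w + w + j.+2 == (w + w).+1 = false by lia.
    by congr (GAnd (cell _ _) (cell _ _)); lia.
  rewrite -[j.+2 in RHS]addn1 iotaD all_cat; cbn [gate_eval].
  by rewrite IH ?(ltnW lt_j) // /= add0n andbT andbC -andbA.
have last_cell k : k < N -> V (cell k (w + w + w)) <->
    (k = 0 \/ V (cell k.-1 (w + w + w))) /\ cmp_ok k.
  move=> lt_k; rewrite -[X in w + w + X](prednK w_gt0) step //; last by lia.
  rewrite (prednK w_gt0) (cmp_okE lt_k); split.
    move=> /andP[h1 /allP h2]; split; first by case: eqP h1; auto.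
    by move=> j lt_j; apply: h2; rewrite mem_iota.
  move=> [h1 h2]; apply/andP; split; first by case: eqP h1 => // ? [].
  by apply/allP => j; rewrite mem_iota => /andP[_]; apply: h2.
elim: i => [|i IH] lt_i.
  rewrite last_cell //; split=> [[_ ok0] i'|h]; first by rewrite leqn0 => /eqP->.
  by split; [left | apply: h].
rewrite last_cell //= IH; last by lia.
split=> [[[//|h] ok] i'|h].
  by rewrite leq_eqVlt => /orP[/eqP->|] //; apply: h.
split; last exact: h.
by right=> i' le_i; apply: h; lia.
Qed.

Definition assignment (v : nat) : bool := V (var_node v).

(** By induction on the formula: in postorder the left subtree ends just before the right one
    begins, so every comparison succeeds, and a node inherits its beginning from its left or only
    child. *)
Lemma value_formula phi d : d + fsize phi <= N ->
  located nd d (formula_nodes d phi) ->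
  [/\ V (cell (d + fsize phi).-1 0) = feval assignment phi,
      start_bits (d + fsize phi).-1 = bits w (d + (2 ^ w).-1)
    & forall i, d <= i < d + fsize phi -> cmp_ok i].
Proof.
have binary f g d' t : let r := d' + fsize f + fsize g in
    r < N -> (t == 3) || (t == 4) -> nd r = (t, (d' + fsize f).-1, r.-1) ->
    start_bits r.-1 = bits w (d' + fsize f + (2 ^ w).-1) ->
    start_bits (d' + fsize f).-1 = bits w (d' + (2 ^ w).-1) ->
    start_bits r = bits w (d' + (2 ^ w).-1) /\ cmp_ok r.
  move=> r lt_r bin_t nd_r sg sf.
  have f_gt0 := fsize_gt0 f; have X_gt0 := expn_gt0 2 w.
  have bin_r : is_binary (nd r) by rewrite nd_r.
  split.
    rewrite start_bits_cell // bin_r {2}nd_r /= sf nd_r /=.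
    by case/orP: bin_t => /eqP->.
  move=> _; rewrite sg nd_r /=.
  (* As [f] is nonempty, [(d' + fsize f).-1] is a true predecessor, and adding [2 ^ w] to it gives
     the number stored for [g]. *)
  rewrite -[RHS](@bits_addX w _ 1) ?muln1; last by lia.
  by congr bits; lia.
elim: phi d => [v|f IHf|f IHf g IHg|f IHf g IHg] d /=.
- rewrite addn1 => lt_d /located1 nd_d; split=> /=.
  + by rewrite value_cell // nd_d.
  + by rewrite start_bits_cell // nd_d.
  + move=> i; rewrite ltnS => /anti_leq <-.
    by rewrite /cmp_ok nd_d.
- rewrite addnS => lt_d /located_cat[lf].
  rewrite size_formula_nodes => /located1 nd_r.
  have [vf sf cf] := IHf d (ltnW lt_d) lf.
  split=> /=.
  + by rewrite value_cell // nd_r /= vf.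
  + by rewrite start_bits_cell // nd_r /= sf.
  + move=> i; rewrite ltnS => /andP[ge_i].
    rewrite leq_eqVlt => /orP[/eqP->|lt_i]; last by apply: cf; rewrite ge_i.
    by rewrite /cmp_ok nd_r.
- rewrite addnS addnA => lt_d /located_cat[lf].
  rewrite size_formula_nodes => /located_cat[lg].
  rewrite size_formula_nodes => /located1 nd_r.
  have [vf sf cf] := IHf d (leq_trans (leq_addr _ _) (ltnW lt_d)) lf.
  have [vg sg cg] := IHg _ (ltnW lt_d) lg.
  have [sr cr] := binary f g d 3 lt_d isT nd_r sg sf.
  split=> //=; first by rewrite value_cell // nd_r /= vf vg.
  move=> i; rewrite ltnS => /andP[ge_i].
  rewrite leq_eqVlt => /orP[/eqP->//|lt_i].
  by case: (ltnP i (d + fsize f)) => cmp_i; [apply: cf | apply: cg]; lia.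
- rewrite addnS addnA => lt_d /located_cat[lf].
  rewrite size_formula_nodes => /located_cat[lg].
  rewrite size_formula_nodes => /located1 nd_r.
  have [vf sf cf] := IHf d (leq_trans (leq_addr _ _) (ltnW lt_d)) lf.
  have [vg sg cg] := IHg _ (ltnW lt_d) lg.
  have [sr cr] := binary f g d 4 lt_d isT nd_r sg sf.
  split=> //=; first by rewrite value_cell // nd_r /= vf vg.
  move=> i; rewrite ltnS => /andP[ge_i].
  rewrite leq_eqVlt => /orP[/eqP->//|lt_i].
  by case: (ltnP i (d + fsize f)) => cmp_i; [apply: cf | apply: cg]; lia.
Qed.

Hypothesis blocks_ok : forall i, i < N -> block_ok N i (nd i) (nd i.+1).

Lemma tag_pred_neq0 i : i.+1 < N -> (nd i.+1).1.1 != 0 -> (nd i).1.1 != 0.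
Proof.
move=> lt_i; apply: contra => /eqP t0.
have := blocks_ok (ltnW lt_i); rewrite /block_ok /inner_ok /is_binary t0 /=.
by rewrite andbF => /= /and3P[_ _ /orP[/eqP eN|//]]; lia.
Qed.

Lemma tag_neq0_le i j : i <= j -> j < N -> (nd j).1.1 != 0 -> (nd i).1.1 != 0.
Proof.
move=> le_ij; rewrite -(subnKC le_ij); elim: (j - i) => [|k IH].
  by rewrite addn0.
by rewrite addnS => lt_k /(tag_pred_neq0 lt_k); apply: IH; apply: ltnW.
Qed.

(** Strong induction on the position of the root. For a binary node, the right child yields a
    subtree beginning at some [d]; the comparison then forces the left address to be [d - 1], and
    the left child yields a subtree ending there. *)
Lemma parse_formula i : i < N -> (nd i).1.1 != 0 ->
  (forall i', i' < N -> cmp_ok i') ->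
  exists phi d, [/\ d + fsize phi = i.+1, vars_below (2 ^ w) phi
                  & located nd d (formula_nodes d phi)].
Proof.
move=> lt_i tag_i cmps; elim/ltn_ind: i => i IH in lt_i tag_i *.
have := blocks_ok lt_i; rewrite /block_ok => /orP[|]; last first.
  by move=> /andP[_ /andP[/andP[t0 _] _]]; rewrite t0 in tag_i.
case E: (nd i) => [[t a] b].
have lt_a : a < 2 ^ w by have := nd_small lt_i; rewrite E.
rewrite /inner_ok /is_binary /= => /or3P[]; rewrite -?andbA.
- move=> /andP[/eqP et /eqP eb]; exists (FVar a), i; split; rewrite ?addn1 //=.
  by apply/located1; rewrite E et eb.
- move=> /and4P[i_gt0 /eqP et /eqP ea /eqP eb].
  have [phi [d [dE vb loc]]] : exists phi d, [/\ d + fsize phi = i.-1.+1,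
      vars_below (2 ^ w) phi & located nd d (formula_nodes d phi)].
    by apply: IH; rewrite ?prednK //; [lia | apply: tag_neq0_le tag_i; lia].
  exists (FNot phi), d; split=> //=; first by lia.
  apply/located_cat; split=> //; rewrite size_formula_nodes; apply/located1.
  by rewrite dE prednK // E et ea eb.
- move=> /and3P[bin_t lt_ai /eqP eb].
  have i_gt0 : 0 < i by lia.
  have [g [d [dE vg lg]]] : exists phi d, [/\ d + fsize phi = i.-1.+1,
      vars_below (2 ^ w) phi & located nd d (formula_nodes d phi)].
    by apply: IH; rewrite ?prednK //; [lia | apply: tag_neq0_le tag_i; lia].
  rewrite prednK // in dE.
  have [_ sg _] := value_formula (d := d) (phi := g) ltac:(lia) lg.
  have := cmps i lt_i; rewrite /cmp_ok /is_binary E => /(_ bin_t) /=.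
  have X_gt0 := expn_gt0 2 w; rewrite /= in X_gt0.
  rewrite -dE sg => eq_a.
  have {eq_a} dE' : d = a.+1.
    (* For [d = 0] the stored number wraps around to [2 ^ w - 1], which cannot be an address below
       [i < N <= 2 ^ w]. *)
    case: d => [|d] in lg sg dE eq_a *.
      by have := bits_inj _ _ eq_a; rewrite add0n => /(_ ltac:(lia) lt_a); lia.
    have e : d.+1 + (2 ^ w).-1 = d + 2 ^ w * 1 by lia.
    have lt_d : d < 2 ^ w by lia.
    by move: eq_a; rewrite e bits_addX // => /(bits_inj lt_d lt_a) ->.
  have [f [d0 [d0E vf lf]]] : exists phi d, [/\ d + fsize phi = a.+1,
      vars_below (2 ^ w) phi & located nd d (formula_nodes d phi)].
    by apply: IH => //; [lia | apply: tag_neq0_le tag_i; lia].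
  have ii : d0 + fsize f + fsize g = i by lia.
  have loc : located nd d0 (formula_nodes d0 f ++ formula_nodes (d0 + fsize f) g
      ++ [:: (t, (d0 + fsize f).-1, (d0 + fsize f + fsize g).-1)]).
    apply/located_cat; split=> //; rewrite size_formula_nodes.
    apply/located_cat; rewrite d0E -dE'; split=> //; rewrite size_formula_nodes.
    by apply/located1; rewrite dE E eb dE'.
  case/orP: bin_t loc => /eqP -> loc.
    by exists (FAnd f g), d0; rewrite /= vf vg; split=> //; lia.
  by exists (FOr f g), d0; rewrite /= vf vg; split=> //; lia.
Qed.

(** Padding blocks copy from their predecessor, so the last block repeats the value and the
    beginning held at the root [r], whose address the circuit does not know in advance. *)
Lemma padding_cells i : i < N ->
  exists r, [/\ r <= i, (nd r).1.1 != 0,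
    forall k, r < k <= i -> nd k = (0, 0, 0)
    & V (cell i 0) = V (cell r 0) /\ start_bits i = start_bits r].
Proof.
elim: i => [|i IH] lt_i.
  exists 0; split=> //; last by move=> k; lia.
  by have := blocks_ok lt_i; rewrite /block_ok /inner_ok /= /is_binary orbF;
    case/orP=> [|]; [move/andP=> [/eqP->] | case/andP=> /orP[] /eqP->].
case: (boolP ((nd i.+1).1.1 == 0)) => [/eqP t0|tN]; last first.
  by exists i.+1; split=> // k; lia.
have [r [le_r tag_r zr [vr sr]]] := IH (ltnW lt_i).
exists r; split=> //; first exact: leqW.
  move=> k /andP[lt_k]; rewrite leq_eqVlt => /orP[/eqP->|lt_ki]; last first.
    by apply: zr; rewrite lt_k.
  have := blocks_ok lt_i; rewrite /block_ok /inner_ok /is_binary t0 /=.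
  case: (nd i.+1) t0 => [[t a] b] /= -> /=.
  by move=> /andP[/andP[/eqP-> /eqP->] _].
by rewrite value_cell // start_bits_cell // /is_binary t0 /= vr sr.
Qed.

(** The test for ones excludes strings in which several formulas follow one another and only the
    last of them is evaluated. *)
Lemma last_cells_correct : 0 < N ->
  [&& V (cell N.-1 0), V (cell N.-1 (w + w + w)) & start_bits N.-1 == nseq w true]
  <-> exists phi, [/\ fsize phi <= N, vars_below (2 ^ w) phi,
        forall i, i < N -> nd i = nth (0, 0, 0) (formula_nodes 0 phi) i
        & feval assignment phi].
Proof.
move=> N_gt0; have lt_N : N.-1 < N by lia.
have X_gt0 := expn_gt0 2 w; rewrite /= in X_gt0.
split.
  move=> /and3P[v_last /(acc_cell lt_N) cmps /eqP s_last].
  have [r [le_r tag_r zr [vr sr]]] := padding_cells lt_N.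
  have [||phi [d [dE vb loc]]] := @parse_formula r _ tag_r; first by lia.
    by move=> i' lt_i'; apply: cmps; lia.
  have [] := @value_formula phi d _ loc; rewrite dE; first by lia.
  rewrite /= -sr s_last -vr v_last -bits_ones => vphi e _.
  (* A beginning [d > 0] with stored number [2 ^ w - 1] would be [2 ^ w], beyond the last node. *)
  have d0 : d = 0.
    case: d => // d in e dE loc *.
    have e' : d.+1 + (2 ^ w).-1 = d + 2 ^ w * 1 by lia.
    have lt_d : d < 2 ^ w by lia.
    move: e; rewrite e' bits_addX // => /bits_inj.
    by have := fsize_gt0 phi; move=> f_gt0 /(_ ltac:(lia) lt_d); lia.
  rewrite d0 add0n in dE loc; exists phi; split=> //; first by lia.
  move=> i lt_i; case: (ltnP i (fsize phi)) => [lt_ip|ge_i].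
    by rewrite -loc ?size_formula_nodes.
  by rewrite nth_default ?size_formula_nodes // zr //; lia.
move=> [phi [le_phi vb ndE sat]].
have phi_gt0 := fsize_gt0 phi.
have loc : located nd 0 (formula_nodes 0 phi).
  by move=> k; rewrite size_formula_nodes add0n => lt_k; apply: ndE; lia.
have [vphi sphi cphi] := value_formula (d := 0) le_phi loc.
rewrite add0n in vphi sphi.
have pad i : fsize phi <= i.+1 -> i < N ->
    V (cell i 0) = V (cell (fsize phi).-1 0) /\
    start_bits i = start_bits (fsize phi).-1.
  elim: i => [|i IH] le_i lt_i; first by have -> : (fsize phi).-1 = 0 by lia.
  case: (ltngtP (fsize phi) i.+2) => [lt_ip| |->] //; last by lia.
  have nd0 : nd i.+1 = (0, 0, 0).
    by rewrite ndE // nth_default // size_formula_nodes.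
  rewrite value_cell // start_bits_cell // nd0 /=; apply: IH; lia.
have [||-> ->] := pad N.-1; try lia.
rewrite vphi sat sphi add0n bits_ones eqxx andbT /=.
apply/(acc_cell lt_N) => i le_i; case: (ltnP i (fsize phi)) => [lt_i|ge_i].
  exact: cphi.
have nd0 : nd i = (0, 0, 0).
  by rewrite ndE ?nth_default ?size_formula_nodes //; lia.
by rewrite /cmp_ok nd0.
Qed.

End Values.
End Layout.

(** * The circuit E_x: correctness *)

Local Arguments const_node : simpl never.

Lemma ltn_bitlen v : v < 2 ^ bitlen v.
Proof. exact: trunc_log_ltn. Qed.

(** Needed for completeness of the local tests: no code of a formula is rejected by [code_check]. *)
Lemma formula_inner_ok phi d k : k < fsize phi ->
  inner_ok (d + k) (nth (0, 0, 0) (formula_nodes d phi) k).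
Proof.
have binary f g d' t k' : (t == 3) || (t == 4) ->
    (k' < fsize f ->
     inner_ok (d' + k') (nth (0, 0, 0) (formula_nodes d' f) k')) ->
    (k' - fsize f < fsize g -> inner_ok (d' + fsize f + (k' - fsize f))
       (nth (0, 0, 0) (formula_nodes (d' + fsize f) g) (k' - fsize f))) ->
    k' < (fsize f + fsize g).+1 ->
    inner_ok (d' + k') (nth (0, 0, 0) (formula_nodes d' f ++
       formula_nodes (d' + fsize f) g ++
       [:: (t, (d' + fsize f).-1, (d' + fsize f + fsize g).-1)]) k').
  move=> bin_t okf okg lt_k; rewrite !nth_cat !size_formula_nodes.
  have f_gt0 := fsize_gt0 f; have g_gt0 := fsize_gt0 g.
  case: (ltnP k' (fsize f)) => [/okf//|ge_k].
  case: (ltnP (k' - fsize f) (fsize g)) => [/okg|ge_k'].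
    by rewrite -addnA subnKC.
  have -> : k' = fsize f + fsize g by lia.
  rewrite addKn subnn /inner_ok /is_binary /= bin_t addnA eqxx andbT /=.
  by apply/or3P; apply: Or33; lia.
elim: phi d k => [v|f IHf|f IHf g IHg|f IHf g IHg] d k /=.
- by case: k.
- rewrite nth_cat size_formula_nodes ltnS => le_k.
  case: ltnP => [|ge_k]; first exact: IHf.
  have -> : k = fsize f by lia.
  have f_gt0 := fsize_gt0 f.
  by rewrite subnn /inner_ok /= eqxx andbT addn_gt0 f_gt0 orbT.
- by move=> lt_k; apply: binary => // ?; [apply: IHf | apply: IHg].
- by move=> lt_k; apply: binary => // ?; [apply: IHf | apply: IHg].
Qed.

Section Check.
Variable n : nat.
Local Notation w := (bitlen n).
Local Notation W := (node_width w).
Local Notation N := (n %/ W).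

Lemma nodes_le : N <= 2 ^ w.
Proof. exact: leq_trans (leq_div n W) (ltnW (ltn_bitlen n)). Qed.

Definition code_check (x : seq bool) : bool :=
  all (fun i => block_ok N i (node w x i) (node w x i.+1)) (iota 0 N) &&
  all (fun k => ~~ nth false x (N * W + k)) (iota 0 (n %% W)).

Lemma tail_zeroP (x : seq bool) :
  reflect (forall k, N * W <= k < n -> nth false x k = false)
    (all (fun k => ~~ nth false x (N * W + k)) (iota 0 (n %% W))).
Proof.
have nE := divn_eq n W.
apply: (iffP allP) => [h k /andP[ge_k lt_k]|h k].
  apply/negbTE; have := h (k - N * W); rewrite subnKC //; apply.
  by rewrite mem_iota; lia.
by rewrite mem_iota => lt_k; rewrite h //; lia.
Qed.

Lemma encodesP (x : n.-tuple bool) phi :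
  encodes x phi <->
  [/\ vars_below (2 ^ w) phi, fsize phi <= N,
      forall i, i < N -> node w x i = nth (0, 0, 0) (formula_nodes 0 phi) i
    & forall k, N * W <= k < n -> nth false x k = false].
Proof.
have szE : (size (formula_code w 0 phi) <= n) = (fsize phi <= N).
  by rewrite leq_divRL // formula_codeE size_flatten_node_code size_formula_nodes.
have le_x i : i < N -> i.+1 * W <= size x.
  by rewrite size_tuple => lt_i; rewrite -leq_divRL.
rewrite /encodes szE formula_codeE; split.
  move=> [vb le_phi] /zpad_nodesP; rewrite size_formula_nodes.
  move=> /(_ le_phi)[blk tl]; split=> // i lt_i.
  apply: node_decode (blk i lt_i); first exact: le_x.
  have le_phi2 : 0 + fsize phi <= 2 ^ w by apply: leq_trans le_phi nodes_le.
  case: (ltnP i (fsize phi)) => [lt_ip|ge_i].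
    apply: (allP (formula_nodes_small vb le_phi2)); apply: mem_nth.
    by rewrite size_formula_nodes.
  by rewrite nth_default ?size_formula_nodes // /node_small /= !expn_gt0.
move=> [vb le_phi ndE tl]; split=> //; apply/zpad_nodesP.
  by rewrite size_formula_nodes.
by split=> // i lt_i; rewrite -ndE // node_codeE // le_x.
Qed.

Lemma encodes_check (x : n.-tuple bool) phi : encodes x phi -> code_check x.
Proof.
move=> /encodesP[vb le_phi ndE tl]; apply/andP; split; last exact/tail_zeroP.
apply/allP => i; rewrite mem_iota add0n => /andP[_ lt_i].
rewrite /block_ok ndE //; case: (ltnP i (fsize phi)) => [lt_ip|ge_i].
  by rewrite -[i in inner_ok i _]add0n formula_inner_ok.
have -> : (i.+1 == N) || ((node w x i.+1).1.1 == 0).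
  case: (ltngtP i.+1 N) => [lt_iN| |] //; last by lia.
  by rewrite ndE // nth_default // size_formula_nodes ltnW.
rewrite nth_default ?size_formula_nodes //= (leq_trans (fsize_gt0 phi)) //.
by rewrite orbT.
Qed.

End Check.

(** * The gate list of E_x *)

Section SatGates.
Variables w be N : nat.
Local Notation X := (2 ^ (be + w)).
Local Notation B := (2 ^ be).

(** Constants are obtained from input 0 and its negation, whatever that input is. The three gates
    are the nodes [X - 3], [X - 2] and [X - 1], so the cells begin exactly at [X]. *)
Definition const_gates : seq gate :=
  [:: GNot 0; GAnd 0 (X - 3); GOr 0 (X - 3)].

Definition block_gates (x : seq bool) : seq gate :=
  mkseq (fun j => block_gate w be (j %/ B) (j %% B) (node w x (j %/ B))) (N * B).

(** Gate 0 joins the value of the root with the comparisons, gates 1 to [w] add the test for ones,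
    and gate [w + 1] negates, since a co-nondeterministic circuit must reject by means of a
    satisfying guess. *)
Definition final_gate (j : nat) : gate :=
  if j == 0 then GAnd (cell w be N.-1 0) (cell w be N.-1 (w + w + w))
  else if j <= w then GAnd (X + N * B + j.-1) (cell w be N.-1 j)
  else GNot (X + N * B + w).

Definition sat_gates (x : seq bool) : seq gate :=
  const_gates ++ block_gates x ++ mkseq final_gate w.+2.

Definition sat_output : nat := X + N * B + w.+1.

Lemma size_sat_gates x : size (sat_gates x) = 3 + N * B + w.+2.
Proof. by rewrite !size_cat !size_mkseq addnA. Qed.

Lemma cellE a o : cell w be a o = X + a * B + o.
Proof. by rewrite /cell expnD; lia. Qed.

Lemma cell_lt a i o o' : a < i -> o' < B -> cell w be a o' < X + i * B + o.
Proof.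
move=> lt_a lt_o; rewrite cellE -addnA -addnA ltn_add2l.
have : a.+1 * B <= i * B by rewrite leq_mul2r lt_a orbT.
by rewrite mulSn; lia.
Qed.

Hypothesis w_gt0 : 0 < w.
Hypothesis lt_be : w + w + w < B.
Hypothesis N_gt0 : 0 < N.
Hypothesis le_N : N <= 2 ^ w.

Lemma blocks_ge : 8 <= X.
Proof.
have : 2 ^ 1 <= 2 ^ w by rewrite leq_exp2l.
rewrite expnD; case: be lt_be => [|[|b]]; rewrite ?expnS; try lia.
Qed.

Section Checked.
Variable x : seq bool.
Hypothesis ok_x : all (fun i => block_ok N i (node w x i) (node w x i.+1)) (iota 0 N).

Lemma node_addr_lt i : (node w x i).1.2 < 2 ^ w.
Proof. exact: field_lt. Qed.

Lemma blocks_okP i : i < N -> block_ok N i (node w x i) (node w x i.+1).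
Proof. by move=> lt_i; apply: (allP ok_x); rewrite mem_iota. Qed.

(** Wires copied from [x] could point forwards. The local tests forbid it: a left address lies below
    [i], and only a leaf can occupy block 0. *)
Lemma block_gate_wf i o : i < N -> o < B ->
  all (fun a => a < X + i * B + o)
    (gate_args (block_gate w be i o (node w x i))).
Proof.
move=> lt_i lt_o; have X_ge := blocks_ge.
have cst_lt b : const_node w be b < X + i * B + o.
  by rewrite /const_node; case: b; lia.
have var_lt : var_node w (node w x i).1.2 < X + i * B + o.
  have := node_addr_lt i; rewrite /var_node.
  have : 2 ^ w * 2 <= X; last by lia.
  rewrite expnD mulnC leq_mul2r; apply/orP; right.
  by case: be lt_be => [|b]; rewrite ?expnS; [lia|have := expn_gt0 2 b; lia].
have bin_lt : is_binary (node w x i) -> (node w x i).1.2 < i.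
  have := blocks_okP lt_i; rewrite /block_ok /inner_ok /is_binary.
  by do !case/orP; do ?[case/andP]; move=> ? ? ?; lia.
have i_gt0 : (node w x i).1.1 != 1 -> 0 < i.
  have := blocks_okP lt_i; rewrite /block_ok /inner_ok /is_binary.
  by case/orP => [/or3P[]|]; do ?[case/andP]; lia.
have prev_lt o' : (node w x i).1.1 != 1 -> o' < B ->
    cell w be i.-1 o' < X + i * B + o.
  by move=> /i_gt0 gt0 lt_o'; apply: cell_lt => //; lia.
have left_lt o' : is_binary (node w x i) -> o' < B ->
    cell w be (node w x i).1.2 o' < X + i * B + o.
  by move=> /bin_lt lt_ai lt_o'; apply: cell_lt.
have t1 : is_binary (node w x i) -> (node w x i).1.1 != 1.
  by rewrite /is_binary => /orP[] /eqP->.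
have B_gt0 : 0 < B by lia.
rewrite /block_gate; case: eqP => [o0|_].
  case: eqP => [_|/eqP tN1]; first by rewrite /= var_lt.
  case: eqP => [_|_]; first by rewrite /= prev_lt.
  case: eqP => [t3|_].
    by rewrite /= prev_lt // left_lt // /is_binary t3.
  case: eqP => [t4|_]; last by rewrite /= prev_lt.
  by rewrite /= prev_lt // left_lt // /is_binary t4.
case: leqP => [le_o|gt_o].
  case: eqP => [_|/eqP tN1]; first by rewrite /= cst_lt.
  by case: ifP => bin; rewrite /= ?left_lt ?prev_lt.
case: leqP => [le_o|gt_o2].
  case: ifP => bin; last by rewrite /= cst_lt.
  by case: ifP => _; rewrite /= prev_lt ?t1 //; lia.
case: leqP => [le_o|gt_o3]; last by rewrite /= cst_lt.
rewrite [all _ _]/= andbT; apply/andP; split; first by rewrite cellE; lia.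
case: eqP => o1; last by rewrite cellE; lia.
case: eqP => i0; first exact: cst_lt.
by apply: cell_lt; lia.
Qed.

Lemma sat_gates_wf : gates_wf (X - 3) (sat_gates x).
Proof.
have X_ge := blocks_ge.
rewrite /sat_gates !gates_wf_cat; apply/and3P; split.
- by rewrite /=; lia.
- have -> : X - 3 + size const_gates = X by rewrite /=; lia.
  apply: gates_wf_nth => j; rewrite size_mkseq => lt_j; rewrite nth_mkseq //.
  rewrite [in X + j](divn_eq j B) addnA.
  by apply: block_gate_wf; rewrite ?ltn_mod ?ltn_divLR; lia.
have -> : X - 3 + size const_gates + size (block_gates x) = X + N * B.
  by rewrite size_mkseq /=; lia.
have last_lt o j : o < B -> cell w be N.-1 o < X + N * B + j.
  by move=> lt_o; apply: cell_lt; lia.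
apply: gates_wf_nth => j; rewrite size_mkseq => lt_j; rewrite nth_mkseq //.
rewrite /final_gate; case: eqP => j0; first by rewrite /= !last_lt //; lia.
by case: leqP => le_j; rewrite /= ?last_lt; lia.
Qed.

Section Run.
Variable inp : seq bool.
Hypothesis sz_inp : size inp = X - 3.
Local Notation V := (nth false (node_vals inp (sat_gates x))).

Lemma sat_node j : j < 3 + N * B + w.+2 ->
  V (X - 3 + j) = gate_eval V (nth (GNot 0) (sat_gates x) j).
Proof.
move=> lt_j; rewrite -sz_inp nth_node_vals_gate ?size_sat_gates // sz_inp.
exact: sat_gates_wf.
Qed.

Lemma sat_const b : V (const_node w be b) = b.
Proof.
have X_ge := blocks_ge.
have e0 := sat_node (j := 0) isT; rewrite addn0 /= in e0.
case: b; rewrite /const_node.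
  have -> : X.-1 = X - 3 + 2 by lia.
  by rewrite sat_node // /= e0 orbN.
have -> : X.-2 = X - 3 + 1 by lia.
by rewrite sat_node // /= e0 andbN.
Qed.

Lemma sat_cell i o : i < N -> o < B ->
  V (cell w be i o) = gate_eval V (block_gate w be i o (node w x i)).
Proof.
have X_ge := blocks_ge; move=> lt_i lt_o.
have lt_j : i * B + o < N * B.
  have : i.+1 * B <= N * B by rewrite leq_mul2r lt_i orbT.
  by rewrite mulSn; lia.
have -> : cell w be i o = X - 3 + (3 + (i * B + o)) by rewrite cellE; lia.
rewrite sat_node; last by lia.
rewrite /sat_gates nth_cat ltnNge leq_addr addKn nth_cat size_mkseq lt_j.
rewrite nth_mkseq // divnMDl ?modnMDl; last by lia.
by rewrite divn_small // modn_small // addn0.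
Qed.

Lemma sat_final j : j < w.+2 ->
  V (X + N * B + j) = gate_eval V (final_gate j).
Proof.
have X_ge := blocks_ge; move=> lt_j.
have -> : X + N * B + j = X - 3 + (3 + (N * B + j)) by lia.
rewrite sat_node; last by lia.
rewrite /sat_gates nth_cat ltnNge leq_addr addKn nth_cat size_mkseq.
by rewrite ltnNge leq_addr addKn nth_mkseq.
Qed.

Lemma sat_output_val :
  V sat_output =
  ~~ [&& V (cell w be N.-1 0), V (cell w be N.-1 (w + w + w))
       & start_bits w be V N.-1 == nseq w true].
Proof.
have acc j : j <= w -> V (X + N * B + j) =
    [&& V (cell w be N.-1 0), V (cell w be N.-1 (w + w + w))
      & all (fun j' => V (cell w be N.-1 j'.+1)) (iota 0 j)].
  elim: j => [|j IH] le_j; first by rewrite sat_final //= andbT.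
  rewrite sat_final ?ltnS 1?ltnW // /final_gate le_j.
  rewrite -[in iota 0 _]addn1 iotaD all_cat /= IH 1?ltnW //.
  by rewrite andbT add0n -!andbA.
rewrite /sat_output sat_final // /final_gate ltnn /= acc //.
congr (~~ [&& _, _ & _]); rewrite /start_bits.
apply/idP/eqP => [/allP h|h].
  apply: (@eq_from_nth _ false); rewrite ?size_mkseq ?size_nseq // => j lt_j.
  by rewrite nth_mkseq // nth_nseq lt_j h // mem_iota.
apply/allP => j; rewrite mem_iota => /andP[_ lt_j].
have := f_equal (fun s => nth false s j) h; rewrite nth_mkseq // nth_nseq lt_j.
by move=> ->.
Qed.

Lemma sat_output_correct :
  V sat_output = false <-> exists phi, [/\ fsize phi <= N, vars_below (2 ^ w) phi,
    forall i, i < N -> node w x i = nth (0, 0, 0) (formula_nodes 0 phi) i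
    & feval (fun v => nth false inp (var_node w v)) phi].
Proof.
have X_ge := blocks_ge.
rewrite sat_output_val.
have iffN b : ~~ b = false <-> b by case: b; split.
rewrite iffN (@last_cells_correct w be N (node w x)) //; last first.
- exact: blocks_okP.
- by move=> i _; apply: node_addr_lt.
- exact: sat_cell.
- exact: sat_const.
have asgE v : v < 2 ^ w ->
    assignment w V v = nth false inp (var_node w v).
  move=> lt_v; apply: nth_node_vals_inp; rewrite sz_inp /var_node.
  have : 2 ^ w * 4 <= X; last by lia.
  rewrite expnD mulnC leq_mul2r; apply/orP; right.
  have : 2 ^ 1 <= 2 ^ w by rewrite leq_exp2l.
  by case: be lt_be => [|[|b]]; rewrite ?expnS; try lia; have := expn_gt0 2 b; lia.
have evalE phi : vars_below (2 ^ w) phi -> feval (assignment w V) phi =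
    feval (fun v => nth false inp (var_node w v)) phi.
  elim: phi => [v|f IHf|f IHf g IHg|f IHf g IHg] /=; first exact: asgE.
  - by move=> /IHf ->.
  - by move=> /andP[/IHf -> /IHg ->].
  - by move=> /andP[/IHf -> /IHg ->].
by split=> -[phi [le vb e ev]]; exists phi; split=> //;
  [rewrite -evalE | rewrite evalE].
Qed.

End Run.
End Checked.
End SatGates.

(** * Computing the description of E_x *)

Lemma size_gate_code w g : size (gate_code w g) = 2 + (w + w).
Proof. by case: g => *; rewrite !size_cat !size_bits. Qed.

Lemma size_flatten_gate_code w gs :
  size (flatten (map (gate_code w) gs)) = size gs * (2 + (w + w)).
Proof.
elim: gs => // g gs IH.
by rewrite -[flatten _]/(gate_code w g ++ flatten _) size_cat size_gate_code IH.
Qed.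

Lemma bits_cell w be v a o : be + w < v -> a < 2 ^ w -> o < 2 ^ be ->
  bits v (cell w be a o) = bits be o ++ bits w a ++ bits (v - be - w) 1.
Proof.
move=> lt_v lt_a lt_o; rewrite -bits_cat // -bits_cat // /cell muln1.
by congr bits; lia.
Qed.

Lemma bits_var w v a : w < v -> a < 2 ^ w ->
  bits v (var_node w a) = bits w a ++ bits (v - w) 1.
Proof.
move=> lt_v lt_a; rewrite -bits_cat // /var_node muln1.
by congr bits; lia.
Qed.

Section BlockCode.
Variables n w i : nat.
Hypothesis n_gt0 : 0 < n.
Hypothesis le_n : i.+1 * node_width w <= n.
Local Notation W := (node_width w).

Lemma node_bounds :
  [/\ i * W + 3 <= n, i * W + 3 + w <= n & i * W + 3 + w + w <= n].
Proof. by move: le_n; rewrite mulSn {1}/node_width; split; lia. Qed.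

Lemma computes1_tag t : t < 2 ^ 3 ->
  computes1 n 8 (fun x => (node w x i).1.1 == t).
Proof. by have [h _ _] := node_bounds; apply: computes1_field_eq. Qed.

Lemma computes1_binary : computes1 n 17 (fun x => is_binary (node w x i)).
Proof. exact: (computes1_or (@computes1_tag 3 isT) (@computes1_tag 4 isT)). Qed.

Lemma computes1_block_ok N : i < N -> N * W <= n ->
  computes1 n (50 * W) (fun x => block_ok N i (node w x i) (node w x i.+1)).
Proof.
move=> lt_i le_N; have [h1 h2 h3] := node_bounds.
have tag t := @computes1_tag t.
have aeq c : c < 2 ^ w -> computes1 n (2 * w + 2) (fun x => (node w x i).1.2 == c).
  by move=> lt_c; apply: computes1_field_eq.
have beq c : c < 2 ^ w -> computes1 n (2 * w + 2) (fun x => (node w x i).2 == c).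
  by move=> lt_c; apply: computes1_field_eq.
have alt : computes1 n (2 * w + 2) (fun x => (node w x i).1.2 < i).
  exact: computes1_field_lt.
have cst b := @computes1_const n b n_gt0.
have nxt : computes1 n 11 (fun x => (i.+1 == N) || ((node w x i.+1).1.1 == 0)).
  case: eqP => [_|/eqP neq]; first by apply: computesW (cst true) _ _.
  have lt_N : i.+2 * W <= n.
    by apply: leq_trans le_N; rewrite leq_mul2r; apply/orP; right; lia.
  have h : i.+1 * W + 3 <= n by move: lt_N; rewrite mulSn {1}/node_width; lia.
  exact: computesW (@computes1_field_eq n (i.+1 * W) 3 0 n_gt0 h isT) _ _.
have X_gt0 : 0 < 2 ^ w by rewrite expn_gt0.
(* If [i.-1] does not fit in [w] bits, no field equals it and the corresponding cases are constantly
   false. *)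
case: (ltnP i.-1 (2 ^ w)) => [lt_X|ge_X].
  have c1 := computes1_and (tag 1 isT) (beq 0 X_gt0).
  have c2 := computes1_and (cst (0 < i))
    (computes1_and (tag 2 isT) (computes1_and (aeq _ lt_X) (beq 0 X_gt0))).
  have c3 := computes1_and computes1_binary (computes1_and alt (beq _ lt_X)).
  have c4 := computes1_and (cst (0 < i)) (computes1_and
    (computes1_and (tag 0 isT) (computes1_and (aeq 0 X_gt0) (beq 0 X_gt0))) nxt).
  apply: computesW (computes1_or (computes1_or c1 (computes1_or c2 c3)) c4) _ _ => //.
  by rewrite /node_width; lia.
have c1 := computes1_and (tag 1 isT) (beq 0 X_gt0).
have c4 := computes1_and (cst (0 < i)) (computes1_and
  (computes1_and (tag 0 isT) (computes1_and (aeq 0 X_gt0) (beq 0 X_gt0))) nxt).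
apply: computesW (computes1_or c1 c4) _ _; first by rewrite /node_width; lia.
move=> x szx; congr [:: _]; rewrite /block_ok /inner_ok.
have a_lt : (node w x i).1.2 < 2 ^ w by apply: field_lt.
have b_lt : (node w x i).2 < 2 ^ w by apply: field_lt.
have -> : (node w x i).1.2 == i.-1 = false by lia.
have -> : (node w x i).2 == i.-1 = false by lia.
by rewrite !andbF !orbF.
Qed.

Variables be v : nat.
Hypothesis lt_v : be + w < v.
Local Notation L := (2 + (v + v)).

Lemma computes_addr_const a : computes n (v + v) (fun=> bits v a).
Proof.
by apply: computesW (computes_const (bits v a) n_gt0) _ _ => //;
  rewrite size_bits mul2n addnn.
Qed.

Lemma computes_left :
  computes n 0 (fun x => bits w (node w x i).1.2).
Proof.
have [_ h _] := node_bounds.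
by apply: computesW (computes_slice h) _ _ => // x szx; rewrite bits_field ?szx.
Qed.

Lemma computes_addr_left o : o < 2 ^ be ->
  computes n (v + v) (fun x => bits v (cell w be (node w x i).1.2 o)).
Proof.
move=> lt_o.
apply: computesW (computes_cat (computes_const (bits be o) n_gt0)
  (computes_cat computes_left
     (computes_const (bits (v - be - w) 1) n_gt0))) _ _.
  by rewrite !size_bits; lia.
by move=> x szx; rewrite bits_cell // field_lt.
Qed.

Lemma computes_addr_var :
  computes n (v + v) (fun x => bits v (var_node w (node w x i).1.2)).
Proof.
apply: computesW (computes_cat computes_left
     (computes_const (bits (v - w) 1) n_gt0)) _ _.
  by rewrite !size_bits; lia.
by move=> x szx; rewrite bits_var // ?field_lt; lia.
Qed.

(** Both the kind of the gate and its wires may depend on [x]. *)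
Definition codable (s : nat) (g : seq bool -> gate) : Prop :=
  computes n s (fun x => gate_code v (g x)).

Lemma codable_not a : computes n (v + v) (fun x => bits v (a x)) ->
  codable (2 * L) (fun x => GNot (a x)).
Proof.
move=> ca; apply: computesW (computes_cat (computes_const (bits 2 1) n_gt0)
  (computes_cat ca (computes_addr_const 0))) _ _ => //.
by rewrite size_bits; lia.
Qed.

Lemma codable_and a b : computes n (v + v) (fun x => bits v (a x)) ->
  computes n (v + v) (fun x => bits v (b x)) ->
  codable (2 * L) (fun x => GAnd (a x) (b x)).
Proof.
move=> ca cb; apply: computesW (computes_cat (computes_const (bits 2 2) n_gt0)
  (computes_cat ca cb)) _ _ => //.
by rewrite size_bits; lia.
Qed.

Lemma codable_or a b : computes n (v + v) (fun x => bits v (a x)) ->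
  computes n (v + v) (fun x => bits v (b x)) ->
  codable (2 * L) (fun x => GOr (a x) (b x)).
Proof.
move=> ca cb; apply: computesW (computes_cat (computes_const (bits 2 3) n_gt0)
  (computes_cat ca cb)) _ _ => //.
by rewrite size_bits; lia.
Qed.

Lemma codable_if s0 s1 s2 b g1 g2 :
  computes1 n s0 b -> codable s1 g1 -> codable s2 g2 ->
  codable (s0 + s1 + s2 + 4 * L) (fun x => if b x then g1 x else g2 x).
Proof.
move=> cb c1 c2; apply: computesW (@computes_if _ _ _ _ L _ _ _ cb c1 c2 _ _) _ _;
  rewrite // => x _; rewrite ?size_gate_code //.
by case: (b x).
Qed.

Lemma codableW s s' g : codable s g -> s <= s' -> codable s' g.
Proof. by move=> cg le_s; apply: computesW cg _ _. Qed.

(** The constant 40 covers four nested case distinctions, each made of a test of constant size, a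
    gate code of cost [2 * L] and a selection of cost [4 * L]. *)
Lemma codable_block o : o < 2 ^ be ->
  codable (40 * L) (fun x => block_gate w be i o (node w x i)).
Proof.
move=> lt_o; rewrite /block_gate /copy_gate.
have be_gt0 : 0 < 2 ^ be by rewrite expn_gt0.
have cp a := computes_addr_const a.
have L_ge : 2 <= L by [].
case: eqP => _.
  apply: codableW (codable_if (computes1_tag (t := 1) isT)
    (codable_and computes_addr_var computes_addr_var)
    (codable_if (computes1_tag (t := 2) isT) (codable_not (cp _))
    (codable_if (computes1_tag (t := 3) isT)
       (codable_and (computes_addr_left be_gt0) (cp _))
    (codable_if (computes1_tag (t := 4) isT)
       (codable_or (computes_addr_left be_gt0) (cp _))
       (codable_and (cp _) (cp _)))))) _.
  by lia.
case: leqP => o_w.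
  apply: codableW (codable_if (computes1_tag (t := 1) isT)
    (codable_and (cp _) (cp _))
    (codable_if computes1_binary
       (codable_and (computes_addr_left lt_o) (computes_addr_left lt_o))
       (codable_and (cp _) (cp _)))) _.
  by lia.
case: leqP => o_ww.
  (* A binary digit of the address field is itself an input bit. *)
  have cbit : computes1 n 0 (fun x => odd ((node w x i).1.2 %/ 2 ^ (o - w.+1))).
    have [_ h _] := node_bounds.
    have lt_p : i * W + 3 + (o - w.+1) < n by lia.
    apply: computesW (computes1_nth lt_p) _ _ => // x szx.
    by rewrite /= /field -nth_bnum nth_take ?nth_drop //; lia.
  apply: codableW (codable_if computes1_binary
    (codable_if cbit (codable_and (cp _) (cp _)) (codable_not (cp _)))
    (codable_and (cp _) (cp _))) _.
  by lia.
by case: leqP => _; apply: codableW (codable_and (cp _) (cp _)) _; lia.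
Qed.

End BlockCode.

(** Each block is tested at a cost proportional to its width, and the widths add up to at most
    [n]. *)
Lemma computes1_code_check n : 0 < n -> computes1 n (60 * n) (code_check n).
Proof.
move=> n_gt0; set w := bitlen n; set W := node_width w; set N := n %/ W.
have nE := divn_eq n W; have lt_r : n %% W < W by rewrite ltn_mod.
have le_N : N * W <= n by apply: leq_trunc_div.
have W_ge : 5 <= W by rewrite /W /w /node_width /bitlen; lia.
case: (posnP N) => [N0|N_gt0].
  apply: computesW (@computes1_all n 1 (fun k x => ~~ nth false x (N * W + k))
    (n %% W) n_gt0 _) _ _.
  - by move=> k lt_k; apply: (@computes1_not _ 0); apply: computes1_nth; lia.
  - by rewrite -/N N0 in nE; lia.
  - by move=> x szx; rewrite /code_check -/w -/W -/N N0.
apply: computesW (computes1_and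
  (@computes1_all n (50 * W)
    (fun i x => block_ok N i (node w x i) (node w x i.+1)) N n_gt0 _)
  (@computes1_all n 1 (fun k x => ~~ nth false x (N * W + k))
    (n %% W) n_gt0 _)) _ _ => //.
- move=> i lt_i; apply: computes1_block_ok => //.
  by apply: leq_trans le_N; rewrite leq_mul2r lt_i orbT.
- by move=> k lt_k; apply: (@computes1_not _ 0); apply: computes1_nth; lia.
- rewrite -/N in nE.
  have : N * 5 <= N * W by rewrite leq_mul2l W_ge orbT.
  have : W <= N * W by rewrite leq_pmull.
  have -> : N * (50 * W).+1 = 50 * (N * W) + N by lia.
  by move: (N * W) nE => u nE; lia.
Qed.

(** * E_x as an input of the refuter *)

Section Compress.
Variables n m s : nat.
Hypothesis m_gt0 : 0 < m.
Hypothesis le_mn : m <= n.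
Local Notation w := (bitlen n).
Local Notation W := (node_width w).
Local Notation N := (n %/ W).
Local Notation be := (bitlen (w + w + w)).
Local Notation X := (2 ^ (be + w)).
Local Notation v := (bitlen (m + s)).
Hypothesis N_gt0 : 0 < N.
Hypothesis le_s : X + N * 2 ^ be + w.+2 <= s.

Definition sat_code (x : seq bool) : seq bool :=
  bits v (X - 3 - m) ++ bits v (sat_output w be N)
  ++ flatten (map (gate_code v) (sat_gates w be N x)).

Definition sat_description (x : seq bool) : seq bool :=
  sat_code x ++ nseq (desc_len m s - size (sat_code x)) false.

Lemma size_sat_code x :
  size (sat_code x) = 2 * v + (3 + N * 2 ^ be + w.+2) * (2 + 2 * v).
Proof.
rewrite /sat_code 2!size_cat 2!size_bits size_flatten_gate_code size_sat_gates.
by rewrite addnA addnn -mul2n.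
Qed.

Lemma vars_fit : 2 ^ w * 4 <= X.
Proof.
rewrite expnD mulnC leq_mul2r; apply/orP; right.
have : 0 < w by [].
have := ltn_bitlen (w + w + w); move: (w) (bitlen _) => u [|[|b]]; rewrite ?expnS; lia.
Qed.

Lemma size_sat_code_le x : size (sat_code x) <= desc_len m s.
Proof.
have X_ge := vars_fit; have gt0 : 0 < 2 ^ w by rewrite expn_gt0.
rewrite size_sat_code /desc_len leq_add2l leq_mul2r; apply/orP; right; lia.
Qed.

Lemma sat_descriptionE x : sat_description x = zpad (desc_len m s) (sat_code x).
Proof.
apply: (@eq_from_nth _ false).
  by rewrite size_cat size_nseq size_tuple subnKC // size_sat_code_le.
rewrite size_cat size_nseq subnKC ?size_sat_code_le // => k lt_k.
rewrite -(tnth_nth _ _ (Ordinal lt_k)) tnth_mktuple /= nth_cat.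
by case: ltnP => // ge_k; rewrite nth_nseq if_same nth_default.
Qed.

Lemma computes_sat_description :
  computes n (40 * desc_len m s) sat_description.
Proof.
have n_gt0 : 0 < n by lia.
have X_ge := vars_fit; have gt0 : 0 < 2 ^ w by rewrite expn_gt0.
have lt_v : be + w < v.
  rewrite -(@ltn_exp2l 2) //; apply: leq_ltn_trans (ltn_bitlen (m + s)); lia.
set L := 2 + (v + v).
have cblk j : j < N * 2 ^ be -> computes n (40 * L) (fun x => gate_code v
    (block_gate w be (j %/ 2 ^ be) (j %% 2 ^ be) (node w x (j %/ 2 ^ be)))).
  move=> lt_j; have lt_i : j %/ 2 ^ be < N by rewrite ltn_divLR ?expn_gt0.
  apply: codable_block => //; last by rewrite ltn_mod expn_gt0.
  by rewrite -leq_divRL.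
have flat_mkseq (F : nat -> gate) l :
    flatten (map (gate_code v) (mkseq F l)) =
    flatten (mkseq (fun j => gate_code v (F j)) l).
  by rewrite /mkseq -map_comp.
(* Only the blocks depend on [x]. All else is constant, including the padding, because the length of
   [sat_code x] is the same for all [x]. *)
have cc := computes_cat (computes_const (bits v (X - 3 - m)) n_gt0)
  (computes_cat (computes_const (bits v (sat_output w be N)) n_gt0)
  (computes_cat (computes_const
     (flatten (map (gate_code v) (const_gates w be))) n_gt0)
  (computes_cat (computes_flatten cblk)
  (computes_cat (computes_const
     (flatten (map (gate_code v) (mkseq (final_gate w be N) w.+2))) n_gt0)
  (computes_const (nseq (desc_len m s - size (sat_code [::])) false) n_gt0))))).
have le_d := size_sat_code_le [::]; have szc := size_sat_code [::].
apply: computesW cc _ _; last first.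
  move=> x szx; rewrite /sat_description !size_sat_code /sat_code /sat_gates.
  by rewrite !map_cat !flatten_cat -!catA flat_mkseq.
rewrite !size_bits !size_flatten_gate_code -/L size_nseq size_mkseq.
have -> : size (const_gates w be) = 3 by [].
have szE : size (sat_code [::]) =
    v + v + (3 * L + N * 2 ^ be * L + w.+2 * L).
  by rewrite szc (_ : 2 + 2 * v = L) ?mulnDl; lia.
rewrite szE in le_d *.
have -> : N * 2 ^ be * (40 * L) = 40 * (N * 2 ^ be * L) by lia.
by move: le_d; move: (N * 2 ^ be * L) (w.+2 * L) (desc_len m s); lia.
Qed.

(** Since [m <= n < 2 ^ w], all variable nodes are guess inputs, so the verdict does not depend on
    [y]. *)
Lemma sat_conCircuit (x : n.-tuple bool) : code_check n x ->
  exists E : conCircuit m, [/\ con_size E <= s,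
    describe s E = zpad (desc_len m s) (sat_code x)
    & forall y, ~~ con_eval E y <-> SAT x].
Proof.
move=> /andP[blk_ok /tail_zeroP tl].
have X_ge := vars_fit; have lt_n := ltn_bitlen n.
have le_mX : m + (X - 3 - m) = X - 3 by lia.
have lt_be := ltn_bitlen (w + w + w).
have wf : gates_wf (m + (X - 3 - m)) (sat_gates w be N x)
    && all (fun a => a < m + (X - 3 - m) + size (sat_gates w be N x))
         [tuple sat_output w be N].
  rewrite le_mX size_sat_gates (@sat_gates_wf w be N) ?nodes_le //=.
  by rewrite /sat_output andbT; lia.
exists (ConCircuit (Circuit wf)); split=> //.
  rewrite -[con_size _]/(X - 3 - m + size (sat_gates w be N x)) size_sat_gates; lia.
move=> y.
have outE (z : (X - 3 - m).-tuple bool) :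
    thead (run (Circuit wf) [tuple of y ++ z]) =
    nth false (node_vals (y ++ z) (sat_gates w be N x)) (sat_output w be N).
  by rewrite /thead (tnth_nth false).
have correct (z : (X - 3 - m).-tuple bool) : _ <-> _ :=
  @sat_output_correct w be N (ltn0Sn _) lt_be N_gt0 (@nodes_le n) x blk_ok (y ++ z)
    (etrans (size_tuple [tuple of y ++ z]) le_mX).
split=> [|[phi /encodesP[vb le_phi ndE _] [a sat_a]]].
  rewrite negb_forall => /existsP[z /=]; rewrite outE => /negbTE/correct.
  move=> [phi [le_phi vb ndE sat_phi]].
  by exists phi; [apply/encodesP | exists (fun u => nth false (y ++ z) (var_node w u))].
  (* Guess [i] is the node [m + i], which holds the variable [i + m - 2 ^ w]; guesses below the
     variable nodes get an arbitrary value. *)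
  pose z := [tuple a (i + m - 2 ^ w) | i < X - 3 - m].
  rewrite negb_forall; apply/existsP; exists z; rewrite /= outE; apply/negbT.
  apply/correct; exists phi; split=> //.
  have zE u : u < 2 ^ w -> nth false (y ++ z) (var_node w u) = a u.
    move=> lt_u; rewrite nth_cat size_tuple /var_node.
    have -> : u + 2 ^ w < m = false by lia.
    have lt_z : u + 2 ^ w - m < X - 3 - m by lia.
    rewrite -[RHS]/(a u) -(tnth_nth _ _ (Ordinal lt_z)) tnth_mktuple /=.
    by congr a; lia.
  have eqE psi : vars_below (2 ^ w) psi ->
      feval (fun u => nth false (y ++ z) (var_node w u)) psi = feval a psi.
    elim: psi => [u|f IHf|f IHf g IHg|f IHf g IHg] /=; first exact: zE.
    - by move=> /IHf ->.
    - by move=> /andP[/IHf -> /IHg ->].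
    - by move=> /andP[/IHf -> /IHg ->].
  by rewrite eqE.
Qed.

End Compress.

Definition decides_SAT (n T : nat) : Prop :=
  exists2 f, computes1 n T f & forall x : n.-tuple bool, f x <-> SAT x.

(** The bound on [s] makes room for [E_x]: since [2 ^ w <= 2 * n] and [2 ^ be <= 6 * w], the nodes
    before the cells and the cells number at most [12 * w * n] each, and [w.+2 <= n]. *)
Lemma decides_SAT_step n m s T (R : circuit (desc_len m s) m) :
  refuter_succeeds R -> 0 < m <= n -> node_width (bitlen n) <= n ->
  16 * n * (3 * bitlen n).+1 <= s ->
  decides_SAT m T ->
  decides_SAT n (60 * n + 40 * desc_len m s + circuit_size R + T).+1.
Proof.
move=> ref_R /andP[m_gt0 le_mn] le_Wn le_s [f cf fP].
set w := bitlen n; set be := bitlen (w + w + w).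
have n_gt0 : 0 < n by lia.
have N_gt0 : 0 < n %/ node_width w by rewrite divn_gt0.
have le_N : n %/ node_width w <= 2 ^ w by apply: nodes_le.
have le_w : 2 ^ w <= 2 * n.
  by rewrite expnS leq_mul2l; apply: trunc_logP.
have w_gt0 : 0 < w by [].
have le_be : 2 ^ be <= 2 * (3 * w).
  rewrite expnS leq_mul2l /=; apply: leq_trans (_ : w + w + w <= _); last by lia.
  by apply: trunc_logP; lia.
have le_X : 2 ^ (be + w) <= 2 * (3 * w) * (2 * n).
  by rewrite expnD leq_mul.
have le_NB : n %/ node_width w * 2 ^ be <= 2 ^ (be + w).
  by rewrite expnD mulnC leq_mul2l le_N orbT.
have lt_wn : w.+2 <= n by move: le_Wn; rewrite -/w /node_width; lia.
have {}le_s : 2 ^ (be + w) + n %/ node_width w * 2 ^ be + w.+2 <= s.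
  apply: leq_trans le_s; rewrite -/w.
  have -> : 16 * n * (3 * w).+1 = 48 * (w * n) + 16 * n by lia.
  have e : 2 * (3 * w) * (2 * n) = 12 * (w * n) by lia.
  by rewrite e in le_X; move: (w * n) le_X => q le_X; lia.
have cd := computes_sat_description m_gt0 le_mn N_gt0 le_s.
have crun := computes_comp cd (computes_run R) _.
exists (fun x => code_check n x &&
  f (map (nth false (node_vals (sat_description n m s x) (gates R))) (outputs R))).
  apply: computesW (computes1_and (computes1_code_check n_gt0)
    (computes_comp (crun _) cf _)) _ _ => //.
  - by move=> x szx; rewrite sat_descriptionE // size_tuple.
  - by move=> x szx; rewrite size_map size_tuple.
  - by lia.
(* A string failing the local tests encodes no formula and is rejected outright; its gate list might
   not even be well formed. *)
move=> x; case ok_x: (code_check n x); last first.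
  by split=> // -[phi /encodes_check]; rewrite ok_x.
have [E [szE descE evE]] := sat_conCircuit m_gt0 le_mn N_gt0 le_s ok_x.
rewrite andTb; set u := map _ _.
have := ref_R E szE; rewrite /= descE; set y := run R _ => ref_E.
have -> : u = y by rewrite /u sat_descriptionE.
split=> [/fP SATy|/(evE y)/negbTE evy].
  by apply/(evE y)/negP => ev; apply: ref_E.
case fy: (f y) => //; case: ref_E; rewrite evy.
by split=> // /fP; rewrite fy.
Qed.

(** * Growth rates and the iteration *)

Lemma decides_SAT_exists n : 0 < n -> exists T, decides_SAT n T.
Proof.
move=> n_gt0.
pose h (x : seq bool) : bool :=
  if excluded_middle_informative (SAT (zpad n x)) then true else false.
have [T cT] := computes1_any h n_gt0; exists T, h => // x.
have xE : zpad n x = x.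
  by apply: eq_from_tnth => i; rewrite tnth_mktuple -tnth_nth.
by rewrite /h xE; case: excluded_middle_informative.
Qed.

(** A deterministic circuit is a co-nondeterministic one with no guesses, and this one leaves no
    error to be found. *)
Lemma decides_SAT_refuter n s T (R : circuit (desc_len n s) n) :
  refuter_succeeds R -> decides_SAT n T -> T <= s -> False.
Proof.
move=> ref_R [f cf fP] le_T.
have [C szC runC] : exists2 C : circuit (n + 0) 1, circuit_size C <= T
    & forall x : n.-tuple bool, forall z : 0.-tuple bool,
        thead (run C [tuple of x ++ z]) = f x.
  have : computes1 (n + 0) T f by rewrite addn0.
  move=> /computes1_circuit[C szC runC]; exists C => // x z.
  by rewrite runC /= (tuple0 z) cats0.
apply: (ref_R (ConCircuit C)); first by rewrite /con_size (leq_trans szC).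
set y := run _ _; rewrite -fP; split.
  by move=> /forallP/(_ [tuple]); rewrite runC.
by move=> fy; apply/forallP => z; rewrite runC.
Qed.

Lemma bitlen_leX v m e : 0 < e -> v <= m ^ e -> bitlen v <= e * bitlen m.
Proof.
move=> e_gt0 le_v.
have lt_v : v < 2 ^ (e * bitlen m).
  apply: leq_ltn_trans le_v _.
  by rewrite mulnC expnM ltn_exp2r // ltn_bitlen.
case: v => [|v] in le_v lt_v *; first by rewrite muln_gt0 e_gt0.
by rewrite /bitlen -(@ltn_exp2l 2) // (leq_ltn_trans (trunc_logP _ _)).
Qed.

(** With [l] the logarithm of [m] and [t] about [l / (2 * e)], one has [a * l.+1 <= 2 * a * e * t.+1
    <= 2 ^ t * 2 ^ t], whose power [e] is at most [2 ^ l]. *)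
Lemma bitlen_expn_le a e :
  exists M, forall m, M <= m -> (a * bitlen m) ^ e <= m.
Proof.
case: e => [|e']; first by exists 1 => m; rewrite expn0.
set e := e'.+1.
exists (2 ^ (2 * e * (2 * a * e))) => m le_m.
have m_gt0 : 0 < m by apply: leq_trans le_m; rewrite expn_gt0.
rewrite /bitlen; set l := trunc_log 2 m.
apply: leq_trans (trunc_logP (ltnSn 1) m_gt0); rewrite -/l.
have le_l : 2 * e * (2 * a * e) <= l by apply: trunc_log_max.
set t := l %/ (2 * e).
have le_t : 2 * a * e <= t by rewrite leq_divRL // mulnC.
have lt_l : l.+1 <= 2 * e * t.+1 by rewrite mulnC ltn_ceil.
have le_tl : 2 * t * e <= l.
  by apply: leq_trans (leq_trunc_div l (2 * e)); rewrite -/t; lia.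
apply: (@leq_trans (2 ^ (2 * t * e))); last by rewrite leq_exp2l.
rewrite expnM leq_exp2r // mul2n -addnn expnD.
apply: (@leq_trans (2 * a * e * t.+1)).
  by apply: leq_trans (leq_mul (leqnn a) lt_l) _; lia.
apply: leq_mul; last exact: ltn_expl.
by apply: leq_trans le_t _; apply: ltnW; apply: ltn_expl.
Qed.

(** Putting all exponents over one denominator reduces the comparison of growth rates to
    natural-number powers. *)
Lemma powfloor_denominator (r : rat) (D : nat) :
  (0 < r)%R -> 0 < D -> `|denq r| %| D ->
  exists2 p : nat, (r * D%:R = p%:R)%R
    & forall n s, (s <= powfloor n r) = (s ^ D <= n ^ p).
Proof.
move=> r_gt0 D_gt0 /dvdnP[e De]; exists (`|numq r| * e).
  rewrite De !natrM -{1}(divq_num_den r) mulrC -mulrA.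
  have -> : ((denq r)%:~R = (`|denq r|%N)%:R :> rat)%R.
    by rewrite pmulrn absz_denq.
  have -> : ((numq r)%:~R = (`|numq r|%N)%:R :> rat)%R.
    by rewrite pmulrn gez0_abs // numq_ge0 ltW.
  rewrite [X in (_ * X)%R]mulrCA divff ?mulr1 1?mulrC //.
  by rewrite pnatr_eq0 absz_eq0 denq_neq0.
move=> n s; rewrite leq_powfloor De mulnC !expnM leq_exp2r //.
by case: e De D_gt0 => // ->.
Qed.

(** * Growth rates for exponents with a common denominator *)

Section Growth.
Variables D K C L : nat.
Hypothesis D_gt0 : 0 < D.
Hypothesis lt_DL : D < L.
Hypothesis lt_LK : L < K.
Hypothesis lt_KC : K < C.
Hypothesis lt_CD : C * D < L * K.

(** With [k = K / D], [c = C / D] and [l = L / D], the numbers [n], [s], [y], [z] are the integer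
    parts of [m ^ l], [m ^ k], [m ^ c], [n ^ k]. The last bound has the summand [s] and the factor 2
    so that an invariant of the form [2 * T <= const + m ^ k] passes from [m] to [n]. *)
Lemma growth_bounds : exists2 M, 0 < M & forall m n s y z, M <= m ->
  (forall u, (u <= n) = (u ^ D <= m ^ L)) ->
  (forall u, (u <= s) = (u ^ D <= m ^ K)) ->
  (forall u, (u <= y) = (u ^ D <= m ^ C)) ->
  (forall u, (u <= z) = (u ^ D <= n ^ K)) ->
  [/\ m < n, node_width (bitlen n) <= n, 16 * n * (3 * bitlen n).+1 <= s
    & s + 2 * (60 * n + 40 * desc_len m s + y).+1 <= z].
Proof.
have [M1 hM1] := bitlen_expn_le (240 * K.+2) D.
have [M2 hM2] := bitlen_expn_le 5 1.
(* The first factor pays for rounding [m ^ l] down to [n], the second for the constant 200 below,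
   after raising to the power [D * D]. *)
pose M3 := 2 ^ (D * K) * 200 ^ (D * D).
exists (M1 + M2 + M3 + 2 ^ D); first by rewrite !addn_gt0 expn_gt0 !orbT.
move=> m n s y z le_m nP sP yP zP.
have [m1 m2 m3 m4] : [/\ M1 <= m, M2 <= m, M3 <= m & 2 ^ D <= m] by split; lia.
have m_ge2 : 2 <= m by apply: leq_trans m4; rewrite -{1}(expn1 2) leq_exp2l.
have m_gt0 : 0 < m by lia.
have bl_gt0 : 0 < bitlen m by [].
(* Distinct numerators differ by at least 1, which leaves a factor [m] to absorb the power [D] of a
   logarithmic term. *)
have small u e e' : u ^ D <= m ^ e -> e < e' ->
    forall b, b <= 240 * K.+2 * bitlen m -> (u * b) ^ D <= m ^ e'.
  move=> le_u lt_e b le_b; apply: (@leq_trans (m ^ e.+1)).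
    rewrite expnMn expnSr leq_mul //; apply: leq_trans (hM1 m m1).
    by rewrite leq_exp2r.
  by rewrite leq_exp2l.
have nD : n ^ D <= m ^ L by rewrite -nP.
have sD : s ^ D <= m ^ K by rewrite -sP.
have leX u e : u ^ D <= m ^ e -> u <= m ^ e.
  move=> h; apply: leq_trans h; case: u => // u.
  by rewrite -{1}(expn1 u.+1) leq_pexp2l.
have lt_mn : m < n.
  rewrite nP; apply: (@leq_trans (m ^ D.+1)); last by rewrite leq_exp2l.
  apply: (@leq_trans ((2 * m) ^ D)); first by rewrite leq_exp2r //; lia.
  by rewrite expnMn expnS leq_mul.
have bl_n : bitlen n <= L * bitlen m by apply: bitlen_leX; [lia | apply: leX].
have le_KL : L * bitlen m <= K * bitlen m by rewrite leq_mul2r ltnW ?orbT.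
have bigb : 240 * K.+2 * bitlen m = 240 * (K * bitlen m) + 480 * bitlen m by lia.
split=> //.
- have := hM2 n; rewrite expn1 /node_width => /(_ (leq_trans m2 (ltnW lt_mn))).
  by have : 0 < bitlen n by []; lia.
- rewrite sP; have -> : 16 * n * (3 * bitlen n).+1 = n * (16 * (3 * bitlen n).+1).
    by lia.
  by apply: small nD _ _ _ => //; lia.
have s_gt0 : 0 < s by rewrite sP exp1n expn_gt0 m_gt0.
have bl_ms : bitlen (m + s) <= K.+1 * bitlen m.
  apply: bitlen_leX => //; apply: (@leq_trans (2 * m ^ K)).
    have le_mK : m <= m ^ K by rewrite -{1}(expn1 m) leq_exp2l //; lia.
    by have := leX _ _ sD; lia.
  by rewrite expnS leq_mul.
have le_ny : n <= y.
  by rewrite yP; apply: leq_trans nD _; rewrite leq_exp2l //; lia.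
have le_sy : s <= y.
  by rewrite yP; apply: leq_trans sD _; rewrite leq_exp2l //; lia.
have le_dy : 40 * desc_len m s <= y.
  rewrite yP; apply: (@leq_trans ((s * (40 * (2 + 4 * bitlen (m + s)))) ^ D)).
    rewrite leq_exp2r // /desc_len; set b := bitlen (m + s).
    have : b <= s * b by rewrite leq_pmull.
    have -> : s * (2 + 2 * b) = 2 * s + 2 * (s * b) by lia.
    have -> : s * (40 * (2 + 4 * b)) = 80 * s + 160 * (s * b) by lia.
    by lia.
  by apply: small sD _ _ _ => //; rewrite mulSn in bl_ms; lia.
have yD : y ^ D <= m ^ C by rewrite -yP.
(* Each of [s], [n] and [40 * desc_len m s] is at most [y], so [127 * y] would do. *)
apply: (@leq_trans (200 * y)); first by lia.
rewrite zP -(leq_exp2r _ _ D_gt0).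
(* Rounding at most halves: [m ^ l < n + 1 <= 2 * n]. *)
have key : m ^ (L * K) <= 2 ^ (D * K) * n ^ (K * D).
  have : m ^ L <= (2 * n) ^ D.
    apply: ltnW; rewrite ltnNge -nP; lia.
  rewrite -(leq_exp2r _ _ (_ : 0 < K)); last by lia.
  by rewrite -!expnM expnMn [K * D]mulnC.
rewrite -!expnM -(@leq_pmul2l (2 ^ (D * K))) ?expn_gt0 //.
apply: leq_trans key; apply: (@leq_trans (m ^ (C * D).+1)).
  rewrite [(200 * y) ^ _]expnMn mulnA expnS; apply: leq_mul => //.
  by rewrite !expnM leq_exp2r.
by rewrite leq_exp2l.
Qed.

End Growth.

Theorem theorem3p2 (k c : rat) (hk : (1 < k)%R) (hkc : (k < c)%R)
    (hck : (c < k ^+ 2)%R) :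
  ~ exists R : forall n : nat, circuit (desc_len n (powfloor n k)) n,
      (forall n : nat, circuit_size (R n) <= powfloor n c) /\
      (exists n0 : nat, forall n : nat, n0 <= n -> refuter_succeeds (R n)).
Proof.
move=> [R [szR [n0 refR]]].
have k_gt0 : (0 < k)%R by apply: lt_trans hk.
have c_gt0 : (0 < c)%R by apply: lt_trans hkc.
have [l lt_cl lt_lk] : exists2 l, (c / k < l)%R & (l < k)%R.
  have lt_ck : (c / k < k)%R by rewrite ltr_pdivrMr.
  by exists ((c / k + k) / 2%:R)%R; have [] := midf_lt lt_ck.
(* This is where [k < c] makes the lengths grow: [l > c / k > 1]. *)
have l_gt1 : (1 < l)%R by apply: lt_trans lt_cl; rewrite ltr_pdivlMr ?mul1r.
have l_gt0 : (0 < l)%R by apply: lt_trans l_gt1.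
rewrite ltr_pdivrMr // in lt_cl.
pose D := `|denq k| * `|denq c| * `|denq l|.
have D_gt0 : 0 < D by rewrite !muln_gt0 !absz_gt0 !denq_neq0.
have DR : (0 < D%:R :> rat)%R by rewrite ltr0n.
have [K kK powk] : exists2 p : nat, (k * D%:R = p%:R)%R
    & forall n s, (s <= powfloor n k) = (s ^ D <= n ^ p).
  by apply: powfloor_denominator; rewrite // /D -mulnA dvdn_mulr.
have [C cC powc] : exists2 p : nat, (c * D%:R = p%:R)%R
    & forall n s, (s <= powfloor n c) = (s ^ D <= n ^ p).
  by apply: powfloor_denominator; rewrite // /D mulnAC dvdn_mull.
have [L lL powl] : exists2 p : nat, (l * D%:R = p%:R)%R
    & forall n s, (s <= powfloor n l) = (s ^ D <= n ^ p).
  by apply: powfloor_denominator; rewrite // /D dvdn_mull.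
clearbody D.
have lt_DL : D < L by rewrite -(ltr_nat rat) -lL ltr_pMl.
have lt_LK : L < K by rewrite -(ltr_nat rat) -lL -kK ltr_pM2r.
have lt_KC : K < C by rewrite -(ltr_nat rat) -kK -cC ltr_pM2r.
have lt_CD : C * D < L * K.
  rewrite -(ltr_nat rat) !natrM -cC -lL -kK [ltRHS]mulrACA -[ltLHS]mulrA.
  by rewrite ltr_pM2r ?mulr_gt0.
clear hk hkc hck k_gt0 c_gt0 lt_cl lt_lk l_gt1 l_gt0 DR kK cC lL.
have [M M_gt0 bounds] := growth_bounds D_gt0 lt_DL lt_LK lt_KC lt_CD.
have [T0 dec0] := @decides_SAT_exists (M + n0) (ltn_addr _ M_gt0).
(* The initial cost [T0] enters once and is never amplified; at each step the previous
   [powfloor m k] is absorbed by the new one. *)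
have chain j : exists m T, [/\ M + n0 + j <= m, decides_SAT m T
    & 2 * T <= 2 * T0 + powfloor m k].
  elim: j => [|j [m [T [le_m dec_m le_T]]]].
    by exists (M + n0), T0; rewrite addn0 leq_addr; split.
  have [lt_mn le_W le_s le_z] := bounds m (powfloor m l) _ _ _
    (leq_trans (leq_trans (leq_addr n0 M) (leq_addr j _)) le_m)
    (powl m) (powk m) (powc m) (powk (powfloor m l)).
  exists (powfloor m l); eexists; split; first by lia.
    apply: (decides_SAT_step (R := R m) _ _ le_W le_s dec_m).
      by apply: refR; lia.
    by lia.
  by have := szR m; lia.
(* After [2 * T0] steps [2 * T0 <= m <= powfloor m k], whence [T <= powfloor m k]. *)
have [m [T [le_m dec_m le_T]]] := chain (2 * T0).
have m_gt0 : 0 < m by apply: leq_trans le_m; rewrite -addnA ltn_addr.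
have le_mk : m <= powfloor m k.
  by rewrite powk; apply: leq_pexp2l => //; apply: ltnW; apply: ltn_trans lt_LK.
have le_Tm : 2 * T0 <= m by apply: leq_trans le_m; apply: leq_addl.
have n0_le : n0 <= m.
  by apply: leq_trans le_m; apply: leq_trans (leq_addl M n0) (leq_addr _ _).
apply: (decides_SAT_refuter (refR m n0_le) dec_m).
rewrite -(leq_pmul2l (ltn0Sn 1)); apply: leq_trans le_T _.
by rewrite [2 * powfloor m k]mul2n -addnn leq_add2r (leq_trans le_Tm).
Qed.
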